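(* Let $\mathbf{d}$ be a Dyck path on an $n\times n$ board with bounce number $|\mathbf{m}|=3$, let $P=P(\mathbf{d})$, and let $G=\mathrm{inc}(P)$. Let $c=|S_1|$, $b=|S_2|$, $a=|S_3|$. Then for every integer $l$ with $0\le l\le\min\{a,b,c\}$, the coefficient of $e_{(n-2l,l,l)}$ in the expansion of $X_G(\mathbf{x},q)$ in the elementary symmetric function basis lies in $\mathbb{N}[q]$.
   Context: A Dyck path on an $n\times n$ board is a sequence $\mathbf{d}=(d_1,\dots,d_{n-1})$ of positive integers with $d_1\le\cdots\le d_{n-1}\le n$ and $d_i\ge i$. The poset $P(\mathbf{d})$ on $[n]$ has relations $i\prec j$ iff $i<n$ and $d_i<j\le n$ (a natural unit interval order). The bounce sequence $\mathbf{m}=(m_0,\dots,m_l)$ is given by $m_0=d_1$, $m_i=d_{m_{i-1}+1}$, stopping at $m_l=n$; the bounce number is $|\mathbf{m}|=l+1$. When $|\mathbf{m}|=3$, $\mathbf{m}=(m_0,m_1,n)$ and $S_1=\{1,\dots,m_0\}$, $S_2=\{m_0+1,\dots,m_1\}$, $S_3=\{m_1+1,\dots,n\}$. The incomparability graph $\mathrm{inc}(P)$ has vertex set $[n]$ with an edge between two elements iff they are incomparable in $P$. For a graph $G$ on vertex set $[n]$, the chromatic quasisymmetric function is $X_G(\mathbf{x},q)=\sum_{\kappa}q^{\mathrm{asc}(\kappa)}\prod_{v}x_{\kappa(v)}$, summed over proper colorings $\kappa:[n]\to\{1,2,3,\dots\}$, where $\mathrm{asc}(\kappa)$ is the number of edges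 $\{i,j\}$ with $i<j$ and $\kappa(i)<\kappa(j)$; for $G=\mathrm{inc}(P(\mathbf{d}))$ it is symmetric in $\mathbf{x}$, and $e_\lambda$ denotes the elementary symmetric functions. *)

(* Defs.v *)
From HB Require Import structures.
From mathcomp Require Import all_boot all_order all_algebra.
From mathcomp Require Import finmap mpoly.

Set Implicit Arguments.
Unset Strict Implicit.
Unset Printing Implicit Defensive.

Import GRing.Theory.

Local Open Scope nat_scope.

(* A path d = (d_1, ..., d_(n-1)) is stored as a sequence, so d_i sits at
   position i.-1. The default value of [nth] gives d_n = n; this is needed by
   the bounce recursion when it evaluates d_(m+1) at m = n - 1. *)
Definition dyck_at (n : nat) (d : seq nat) (i : nat) : nat := nth n d i.-1.

(* Positivity of the d_i follows from i <= d_i. *)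
Definition dyck_path (n : nat) (d : seq nat) : Prop :=
  [/\ size d = n.-1, sorted leq d &
      forall i, 1 <= i < n -> i <= dyck_at n d i <= n].

(* The ordinal i : 'I_n stands for the element i.+1 of [n] = {1, ..., n}. *)
Definition dyck_lt (n : nat) (d : seq nat) : rel 'I_n :=
  fun i j => (i.+1 < n) && (dyck_at n d i.+1 < j.+1 <= n).

Definition inc_graph (n : nat) (lt : rel 'I_n) : rel 'I_n :=
  fun i j => [&& i != j, ~~ lt i j & ~~ lt j i].

(* m = (m_0, ..., m_l) with m_0 = d_1, m_i = d_(m_(i-1) + 1), where m_l is the
   first term equal to n; the bounce number is the size of m. *)
Definition bounce_seq (n : nat) (d m : seq nat) : bool :=
  if m is m0 :: m' then
    [&& m0 == dyck_at n d 1,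
        path (fun x y => (x != n) && (y == dyck_at n d x.+1)) m0 m' &
        last m0 m' == n]
  else false.

(* The block S_(k+1) = {m_(k-1) + 1, ..., m_k}, where m_(-1) = 0. *)
Definition bounce_block (n : nat) (m : seq nat) (k : nat) : {set 'I_n} :=
  [set v : 'I_n | nth 0 (0 :: m) k < v.+1 <= nth 0 m k].

Definition is_part (s : seq nat) : bool := sorted geq s && (0 \notin s).

Record intpart := IntPart { parts :> seq nat; _ : is_part parts }.

HB.instance Definition _ := [isSub for parts].
HB.instance Definition _ := [Choice of intpart by <:].

Lemma mkpart_subproof (s : seq nat) :
  is_part (sort geq [seq i <- s | 0 < i]).
Proof.
by rewrite /is_part mem_sort mem_filter andbC sort_sorted // => x y; exact: leq_total.
Qed.

(* Zero entries are dropped, so that (n, 0, 0) is the partition (n). *)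
Definition mkpart (s : seq nat) : intpart := IntPart (mkpart_subproof s).

Definition proper_coloring (n N : nat) (E : rel 'I_n)
    (kappa : {ffun 'I_n -> 'I_N}) : bool :=
  [forall i, forall j, E i j ==> (kappa i != kappa j)].

Definition asc (n N : nat) (E : rel 'I_n) (kappa : {ffun 'I_n -> 'I_N}) : nat :=
  #|[set p : 'I_n * 'I_n |
      [&& E p.1 p.2, p.1 < p.2 & kappa p.1 < kappa p.2]]|.

Local Open Scope ring_scope.

(* A symmetric function in x_1, x_2, ... is handled through its restrictions
   to x_1, ..., x_N for all N (the ring of symmetric functions being the
   inverse limit of the rings of symmetric polynomials); setting
   x_(N+1) = x_(N+2) = ... = 0 keeps exactly the colorings with values in
   {1, ..., N}. The coefficient ring is Z[q] = {poly int}. *)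
Definition chrom_qsym (n N : nat) (E : rel 'I_n) : {mpoly {poly int}[N]} :=
  \sum_(kappa : {ffun 'I_n -> 'I_N} | proper_coloring E kappa)
     ('X^(asc E kappa) : {poly int}) *: \prod_(v < n) 'X_(kappa v).

Definition elem_sym (N : nat) (la : intpart) : {mpoly {poly int}[N]} :=
  \prod_(k <- la) mesym N {poly int} k.

(* X_G = \sum_la c_la e_la as symmetric functions, c being finitely supported *)
Definition e_expansion (n : nat) (E : rel 'I_n)
    (c : {fsfun intpart -> {poly int} with 0}) : Prop :=
  forall N : nat,
    chrom_qsym N E = \sum_(la <- finsupp c) c la *: elem_sym N la.

(* Main.v *)
Require Import Defs.
From mathcomp Require Import all_boot all_order all_algebra.
From mathcomp Require Import finmap mpoly.
From mathcomp Require Import ring zify.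

Set Implicit Arguments.
Unset Strict Implicit.
Unset Printing Implicit Defensive.

Import Order.TTheory GRing.Theory Num.Theory.

Local Open Scope ring_scope.

(* For bounce number 3 a colour class is a chain of P, hence has at most three
   elements, so only e_la with at most three parts occur, and the coefficient of
   x_1^3 ... x_l^3 in e_la is e_(la - (l, l, l)) in the other variables when la
   has three parts. Thus the coefficient of e_(n - 2l, l, l) in X_G is a sum of
   powers of q times coefficients of e_k, k = n - 3l, in X_H, where H runs over
   the graphs left after removing l disjoint 3-chains.

   The coefficient of e_k is extracted by the functional
     F |-> sum over compositions al of k of (-1)^(k - length al) al_1 [x^al] F,
   which is (up to sign) the pairing with the power sum p_k. On X_H the blocks
   after the first one sum to the acyclic orientation polynomial, which for a
   unit interval graph is the product of the [1 + number of lower neighbours]_q;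
   what remains is a sum over the first block only, and removing the largest
   vertex gives a recursion with coefficients in N[q].

   The expansion exists because X_G is symmetric (two colours induce a union of
   increasing paths) and because the e_la are unitriangular in the monomials. *)

(* The sum of the (-1)^(sumn al - size al) w al over the words al of length at
   most [j] in the letters 1, ..., K. There is no constraint on [sumn al], as the
   [w] of interest vanish outside one degree. *)
Fixpoint alt_sum K j (w : seq nat -> {poly int}) : {poly int} :=
  w [::] +
  if j is j'.+1 then
    \sum_(a < K) (-1) ^+ a * alt_sum K j' (fun al => w (a.+1 :: al))
  else 0.

Definition head_sum (h : nat -> {poly int}) K j (w : seq nat -> {poly int}) :=
  \sum_(a < K) (-1) ^+ a * h a.+1 * alt_sum K j (fun al => w (a.+1 :: al)).

Lemma alt_sumS K j w : alt_sum K j.+1 w = w [::] + head_sum (fun=> 1) K j w.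
Proof. by congr (_ + _); apply: eq_bigr => a _; rewrite mulr1. Qed.

Section Linearity.

Variables (I : Type) (r : seq I) (P : pred I) (c : I -> {poly int}).

Lemma alt_sum_linear K j (w : I -> seq nat -> {poly int}) w0 :
  (forall al, w0 al = \sum_(i <- r | P i) c i * w i al) ->
  alt_sum K j w0 = \sum_(i <- r | P i) c i * alt_sum K j (w i).
Proof.
elim: j w w0 => [|j IH] w w0 e /=.
  by rewrite addr0 e; apply: eq_bigr => i _; rewrite addr0.
rewrite e; under [RHS]eq_bigr => i _ do rewrite mulrDr.
rewrite big_split; congr (_ + _) => /=.
under eq_bigr => a _ do rewrite (IH (fun i al => w i (a.+1 :: al))) ?mulr_sumr //.
rewrite exchange_big /=; apply: eq_bigr => i _; rewrite mulr_sumr.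
by apply: eq_bigr => a _; rewrite mulrCA.
Qed.

Lemma head_sum_linear h K j (w : I -> seq nat -> {poly int}) w0 :
  (forall al, w0 al = \sum_(i <- r | P i) c i * w i al) ->
  head_sum h K j w0 = \sum_(i <- r | P i) c i * head_sum h K j (w i).
Proof.
move=> e; rewrite /head_sum.
under eq_bigr => a _ do
  rewrite (@alt_sum_linear _ _ (fun i al => w i (a.+1 :: al))) ?mulr_sumr //.
rewrite exchange_big /=; apply: eq_bigr => i _; rewrite mulr_sumr.
by apply: eq_bigr => a _; rewrite mulrCA.
Qed.

End Linearity.

Lemma sum_card_classes (T : finType) (K : nat) (P : pred {set T})
    (F : {set T} -> {poly int}) (G : nat -> {poly int}) : (#|T| <= K)%N ->
  \sum_(a < K) G a.+1 * (\sum_(C : {set T} | P C && (#|C| == a.+1)) F C) =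
  \sum_(C : {set T} | P C && (C != set0)) G #|C| * F C.
Proof.
move=> TK; under eq_bigr => a _ do rewrite mulr_sumr.
rewrite (exchange_big_dep (fun C : {set T} => P C && (C != set0))) /=; last first.
  by move=> a C _ /andP[-> /eqP cC]; rewrite -card_gt0 cC.
apply: eq_bigr => C /andP[-> C0] /=.
have cK : (#|C|.-1 < K)%N.
  by apply: leq_trans TK; rewrite prednK ?card_gt0 // max_card.
rewrite (big_pred1 (Ordinal cK)) /= ?prednK ?card_gt0 // => a.
by rewrite /pred1 /= -val_eqE /= -[RHS]eqSS prednK ?card_gt0 // eq_sym.
Qed.

Lemma sum_subsetU1 (T : finType) (V : nmodType) (v : T) (R : {set T})
    (F : {set T} -> V) : v \notin R ->
  \sum_(C : {set T} | C \subset v |: R) F C =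
  \sum_(C : {set T} | C \subset R) (F C + F (v |: C)).
Proof.
move=> vR; rewrite (bigID (fun C : {set T} => v \in C)) /= addrC big_split /=.
congr (_ + _).
  apply: eq_bigl => C; apply/andP/idP => [[/subsetP CR vC]|CR].
    apply/subsetP => u uC; move: (CR u uC); rewrite !inE.
    by case: eqP => // uv; rewrite -uv uC in vC.
  split; first by rewrite (subset_trans CR) // subsetUr.
  by apply: contra vR; apply: (subsetP CR).
rewrite (reindex_onto (fun C => v |: C) (fun C => C :\ v)) /=; last first.
  by move=> C /andP[_ vC]; rewrite setD1K.
apply: eq_bigl => C; rewrite setU11 andbT.
apply/andP/idP => [[CR /eqP vC]|CR].
  have vnC : v \notin C by rewrite -vC !inE eqxx.
  apply/subsetP => u uC; have := subsetP CR u; rewrite !inE uC orbT => /(_ isT).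
  by case: eqP => // uv; rewrite -uv uC in vnC.
split; first by rewrite setUS.
rewrite setU1K //; apply: contra vR; exact: (subsetP CR).
Qed.

Lemma sum_setU (T : finType) (A B : {set T}) (F : T -> nat) : [disjoint A & B] ->
  (\sum_(i in A :|: B) F i = \sum_(i in A) F i + \sum_(i in B) F i)%N.
Proof. by move=> dAB; rewrite -bigU //; apply: eq_bigl => i; rewrite !inE. Qed.

(** * Unit interval orders and the first block *)

Section UnitInterval.

Variables (n : nat) (prec : rel 'I_n).
Hypothesis prec_lt : forall i j, prec i j -> (i < j)%N.
Hypothesis prec_mono : forall i i' j j' : 'I_n,
  (i' <= i)%N -> prec i j -> (j <= j')%N -> prec i' j'.

Implicit Types (u v : 'I_n) (R C D B U : {set 'I_n}).

Definition adj_lt u v := (u < v)%N && ~~ prec u v.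

Definition ascs C B : nat := (\sum_(i in C) \sum_(j in B) adj_lt i j)%N.

Definition chain C :=
  [forall i in C, forall j in C, ((i < j)%N) ==> prec i j].

Definition lower_deg v C : nat := (\sum_(i in C) adj_lt i v)%N.

Definition qint k : {poly int} := \sum_(i < k) 'X^i.

Lemma qintS k : qint k.+1 = 1 + 'X * qint k.
Proof.
rewrite /qint big_ord_recl expr0 mulr_sumr; congr (_ + _).
by apply: eq_bigr => i _; rewrite exprS.
Qed.

Definition above v R := [forall u in R, (u < v)%N].

Lemma aboveP v R : reflect (forall u, u \in R -> (u < v)%N) (above v R).
Proof. exact: forall_inP. Qed.

Lemma above_notin v R : above v R -> v \notin R.
Proof. by move/aboveP => h; apply/negP => /h; rewrite ltnn. Qed.

Lemma above_sub v R C : C \subset R -> above v R -> above v C.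
Proof. by move=> /subsetP CR /aboveP h; apply/aboveP => u /CR /h. Qed.

Lemma chainP C : reflect
  (forall i j, i \in C -> j \in C -> (i < j)%N -> prec i j) (chain C).
Proof.
apply: (iffP forall_inP) => h.
  by move=> i j iC jC; move/forall_inP: (h i iC) => /(_ j jC)/implyP.
by move=> i iC; apply/forall_inP => j jC; apply/implyP; apply: h.
Qed.

Lemma chain0 : chain set0.
Proof. by apply/chainP => i j; rewrite inE. Qed.

Lemma ascs0l B : ascs set0 B = 0%N.
Proof. by rewrite /ascs big_set0. Qed.

Lemma lower_deg0 v : lower_deg v set0 = 0%N.
Proof. by rewrite /lower_deg big_set0. Qed.

Lemma lower_deg_eq0 v C : above v C ->
  (lower_deg v C == 0%N) = [forall u in C, prec u v].
Proof.
move=> /aboveP vC; rewrite sum_nat_eq0; apply: eq_forallb => u.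
by apply: implyb_id2l => uC; rewrite /adj_lt vC //= eqb0 negbK.
Qed.

Lemma lower_deg_setD v C R : C \subset R ->
  lower_deg v R = (lower_deg v C + lower_deg v (R :\: C))%N.
Proof. by move=> CR; rewrite /lower_deg (big_setID C) /= (setIidPr CR). Qed.

Lemma chainU1 v C : above v C ->
  chain (v |: C) = chain C && (lower_deg v C == 0%N).
Proof.
move=> vC; rewrite lower_deg_eq0 //.
have {}vC := aboveP _ _ vC.
apply/chainP/andP => [h|[/chainP h /forall_inP hv]].
  split; first by apply/chainP => i j iC jC; apply: h; rewrite inE ?iC ?jC orbT.
  by apply/forall_inP => u uC; apply: h; rewrite ?inE ?uC ?eqxx ?orbT ?vC.
move=> i j /setU1P[->|iC] /setU1P[->|jC]; first by rewrite ltnn.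
- by move/ltn_trans => /(_ _ (vC _ jC)); rewrite ltnn.
- by move=> _; apply: hv.
- exact: h.
Qed.

Lemma chain_lower_deg v C : chain C -> above v C -> (lower_deg v C <= 1)%N.
Proof.
move=> /chainP chC /aboveP vC.
rewrite leqNgt; apply/negP => h.
have: (1 < #|[set u in C | adj_lt u v]|)%N.
  apply: leq_trans h _; rewrite /lower_deg -sum1_card big_set [X in (_ <= X)%N]big_mkcondr.
  by apply: leq_sum => i _; case: adj_lt.
case/card_gt1P => x [y] []; rewrite !inE /adj_lt.
move=> /andP[xC /andP[_ /negP xv]] /andP[yC /andP[_ /negP yv]].
case: (ltngtP x y) => [xy|yx|/val_inj -> /eqP//] _.
  by apply: xv; apply: prec_mono (leqnn _) (chC _ _ xC yC xy) (ltnW (vC _ yC)).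
by apply: yv; apply: prec_mono (leqnn _) (chC _ _ yC xC yx) (ltnW (vC _ xC)).
Qed.

Lemma ascsUr C B B' : [disjoint B & B'] ->
  ascs C (B :|: B') = (ascs C B + ascs C B')%N.
Proof.
by move=> d; rewrite /ascs -big_split /=; apply: eq_bigr => i _; rewrite sum_setU.
Qed.

Lemma ascsUl C C' B : [disjoint C & C'] ->
  ascs (C :|: C') B = (ascs C B + ascs C' B)%N.
Proof. by move=> d; rewrite /ascs sum_setU. Qed.

Lemma ascs1r C v : ascs C [set v] = lower_deg v C.
Proof. by apply: eq_bigr => i _; rewrite big_set1. Qed.

Lemma ascs1l v B : above v B -> ascs [set v] B = 0%N.
Proof.
move=> /aboveP vB; rewrite /ascs big_set1 big1 // => j jB.
by rewrite /adj_lt ltnNge ltnW ?vB.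
Qed.

Lemma ascsU1l v C B : v \notin C -> above v B -> ascs (v |: C) B = ascs C B.
Proof. by move=> vC vB; rewrite ascsUl ?disjoints1 // ascs1l. Qed.

Lemma ascsU1r v C B : v \notin B -> ascs C (v |: B) = (ascs C B + lower_deg v C)%N.
Proof. by move=> vB; rewrite ascsUr ?disjoints1 // ascs1r addnC. Qed.

Lemma setU1D v R C : v \notin C -> (v |: R) :\: C = v |: (R :\: C).
Proof.
move=> vC; apply/setP => u; rewrite !inE.
by case: eqP => [->|]; rewrite /= ?vC.
Qed.

Lemma setU1DU1 v R C : v \notin R -> (v |: R) :\: (v |: C) = R :\: C.
Proof.
move=> vR; apply/setP => u; rewrite !inE negb_or.
by case: eqP => [->|]; rewrite //= (negbTE vR) andbF.
Qed.

(* The acyclic orientations of the graph on [R], counted by ascents. *)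
Definition orientations R : {poly int} :=
  \prod_(v in R) qint (lower_deg v R).+1.

Lemma orientations0 : orientations set0 = 1.
Proof. by rewrite /orientations big_set0. Qed.

Lemma orientationsU1 v R : above v R ->
  orientations (v |: R) = qint (lower_deg v R).+1 * orientations R.
Proof.
move=> vR; rewrite /orientations big_setU1 ?above_notin //=.
have E u : (u <= v)%N -> lower_deg u (v |: R) = lower_deg u R.
  move=> uv; rewrite /lower_deg big_setU1 ?above_notin //=.
  by rewrite /adj_lt ltnNge uv.
rewrite E //; congr (_ * _); apply: eq_bigr => u uR.
by rewrite E // ltnW // (aboveP _ _ vR).
Qed.

Definition peel_term (g : {set 'I_n} -> {poly int}) R C : {poly int} :=
  if (C != set0) && chain C then
    (-1) ^+ #|C|.+1 * g C * 'X^(ascs C (R :\: C)) * orientations (R :\: C)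
  else 0.

Lemma peel_term0 g R : peel_term g R set0 = 0.
Proof. by rewrite /peel_term eqxx. Qed.

Definition peel_sum g R : {poly int} :=
  \sum_(C : {set 'I_n} | C \subset R) peel_term g R C.

Lemma peel_sum0 g : peel_sum g set0 = 0.
Proof. by apply: big1 => C; rewrite subset0 => /eqP ->; rewrite peel_term0. Qed.

Lemma eq_peel_sum g g' R : (forall C, C \subset R -> C != set0 -> g C = g' C) ->
  peel_sum g R = peel_sum g' R.
Proof.
move=> e; apply: eq_bigr => C CR; rewrite /peel_term.
by case: ifP => // /andP[C0 _]; rewrite e.
Qed.

Lemma peel_sum_eq0 g R : (forall C, C \subset R -> C != set0 -> g C = 0) ->
  peel_sum g R = 0.
Proof.
move=> e; apply: big1 => C CR; rewrite /peel_term.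
by case: ifP => // /andP[C0 _]; rewrite e // mulr0 !mul0r.
Qed.

Lemma peel_sumD g g' R :
  peel_sum (fun C => g C + g' C) R = peel_sum g R + peel_sum g' R.
Proof.
rewrite -big_split /=; apply: eq_bigr => C _; rewrite /peel_term.
by case: ifP; rewrite ?addr0 // => _; rewrite mulrDr !mulrDl.
Qed.

Lemma peel_sumN g R : peel_sum (fun C => - g C) R = - peel_sum g R.
Proof.
rewrite -sumrN; apply: eq_bigr => C _; rewrite /peel_term.
by case: ifP; rewrite ?oppr0 // => _; rewrite mulrN !mulNr.
Qed.

(* Since [lower_deg v C] is 0 or 1 for a chain [C], adding a new top vertex
   multiplies each term by q[deg v], up to a correction supported on the chains
   that [v] extends. *)
Lemma peel_sumU1 g v R : above v R ->
  peel_sum g (v |: R) =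
  g [set v] * orientations R + 'X * qint (lower_deg v R) * peel_sum g R +
  peel_sum (fun C => (lower_deg v C == 0%N)%:R * (g C - g (v |: C))) R.
Proof.
move=> vR; have vnR := above_notin vR.
rewrite {1}/peel_sum sum_subsetU1 // mulr_sumr.
rewrite (bigD1 set0) ?sub0set //= [X in _ = _ + X](bigD1 set0) ?sub0set //=.
rewrite [X in _ = _ + X + _](bigD1 set0) ?sub0set //=.
rewrite !peel_term0 !mulr0 !add0r -addrA -big_split /=.
congr (_ + _).
  rewrite /peel_term setU0 -card_gt0 cards1 /= -signr_odd /= expr0 mul1r.
  have -> : chain [set v].
    by rewrite -[[set v]]setU0 chainU1 ?chain0 ?lower_deg0 //; apply/aboveP=> u; rewrite inE.
  have -> : (v |: R) :\ v = R by rewrite setU1K.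
  by rewrite ascs1l // mulr1.
apply: eq_bigr => C /andP[CR C0]; rewrite /peel_term C0 /=.
have vC := above_sub CR vR.
have vD : above v (R :\: C) by apply: above_sub vR; rewrite subsetDl.
have -> : v |: C != set0 by apply/set0Pn; exists v; rewrite setU11.
rewrite chainU1 // setU1D ?above_notin // setU1DU1 //.
case chC: (chain C) => /=; last by rewrite mulr0 !addr0.
rewrite ascsU1l ?above_notin // ascsU1r ?above_notin // orientationsU1 //.
rewrite cardsU1 above_notin //= (lower_deg_setD v CR).
have := chain_lower_deg chC vC; case: (lower_deg v C) => [|[|//]] _ /=.
  rewrite addn0 add0n mul1r [X in X * g (v |: C)]exprS qintS.
  by set a := (-1) ^+ _; set b := 'X^ _; ring.
rewrite exprD expr1 add1n mul0r mulr0 !mul0r !addr0.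
by set a := (-1) ^+ _; set b := 'X^ _; ring.
Qed.

Lemma above_max R : R != set0 ->
  exists v, exists2 R', R = v |: R' & above v R' /\ (#|R| = #|R'|.+1).
Proof.
case/set0Pn => u0 u0R; case: (arg_maxnP (fun u : 'I_n => val u) u0R) => v vR0 vmax; have vR : v \in R := vR0.
exists v, (R :\ v); first by rewrite setD1K.
split; last by rewrite (cardsD1 v R) vR.
apply/aboveP => u; rewrite !inE => /andP[uv uR].
by rewrite ltn_neqAle (inj_eq val_inj) uv; apply: vmax.
Qed.

Lemma set_above_ind (Q : {set 'I_n} -> Prop) :
  Q set0 -> (forall v R, above v R -> Q R -> Q (v |: R)) -> forall R, Q R.
Proof.
move=> Q0 QS R; move: {2}#|R| (erefl #|R|) => m; elim: m R => [|m IH] R cR.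
  by move/eqP: cR; rewrite cards_eq0 => /eqP ->.
have R0 : R != set0 by rewrite -cards_eq0 cR.
have [v [R' eR [vR' cR']]] := above_max R0.
by rewrite eR; apply: QS => //; apply: IH; rewrite cR' in cR; case: cR.
Qed.

Lemma peel_orientations R :
  orientations R = (R == set0)%:R + peel_sum (fun=> 1) R.
Proof.
elim/set_above_ind: R => [|v R vR IH].
  by rewrite orientations0 eqxx peel_sum0 addr0.
rewrite peel_sumU1 // mul1r orientationsU1 //.
have -> : v |: R == set0 = false by apply/set0Pn; exists v; rewrite setU11.
rewrite add0r [X in _ = _ + X]peel_sum_eq0 ?addr0; last first.
  by move=> C _ _; rewrite subrr mulr0.
rewrite qintS mulrDl mul1r; congr (_ + _).
have [->|R0] := eqVneq R set0.
  by rewrite lower_deg0 /qint big_ord0 mulr0 !mul0r.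
by rewrite {1}IH (negbTE R0) add0r.
Qed.

Definition npoly (p : {poly int}) := forall i, 0 <= p`_i.

Lemma npolyD p q : npoly p -> npoly q -> npoly (p + q).
Proof. by move=> hp hq i; rewrite coefD addr_ge0. Qed.

Lemma npolyM p q : npoly p -> npoly q -> npoly (p * q).
Proof. by move=> hp hq i; rewrite coefM sumr_ge0 // => j _; rewrite mulr_ge0. Qed.

Lemma npoly_nat k : npoly k%:R.
Proof. by move=> i; rewrite -polyC_natr coefC; case: eqP. Qed.

Lemma npoly_sum I (r : seq I) (P : pred I) (F : I -> {poly int}) :
  (forall i, P i -> npoly (F i)) -> npoly (\sum_(i <- r | P i) F i).
Proof. by move=> h i; rewrite coef_sum sumr_ge0 // => k /h. Qed.

Lemma npolyXn k : npoly 'X^k.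
Proof. by move=> i; rewrite coefXn; case: eqP. Qed.

Lemma npoly_qint k : npoly (qint k).
Proof. by apply: npoly_sum => i _; apply: npolyXn. Qed.

Lemma npoly_orientations R : npoly (orientations R).
Proof.
apply: (big_ind npoly) => [||v _]; [exact: (npoly_nat 1)|exact: npolyM|exact: npoly_qint].
Qed.

Definition meets D C := C :&: D != set0.

Lemma nbrs_threshold v R : above v R ->
  exists s, forall u, u \in R -> (s <= u)%N = ~~ prec u v.
Proof.
move=> vR.
pose P := [pred s : nat | [forall u in R, (s <= u)%N ==> ~~ prec u v]].
have exP : exists s, P s.
  by exists n; apply/forall_inP => u _; apply/implyP; rewrite leqNgt ltn_ord.
case: (ex_minnP exP) => s /forall_inP Ps smin; exists s => u uR.
apply/idP/idP => [|nuv]; first by apply/implyP; apply: Ps.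
rewrite leqNgt; apply/negP => us.
have: P u; last by move/smin; rewrite leqNgt us.
apply/forall_inP => u' u'R; apply/implyP => uu'; apply/negP => u'v.
by move/negP: nuv; apply; apply: prec_mono uu' u'v (leqnn _).
Qed.

Lemma nbrs_clique v R s : above v R ->
  (forall u, u \in R -> (s <= u)%N = ~~ prec u v) ->
  forall u u', u \in R -> u' \in R -> (s <= u)%N -> (s <= u')%N -> ~~ prec u u'.
Proof.
move=> vR sP u u' uR u'R su _; rewrite sP // in su.
by apply: contra su => uu'; apply: prec_mono (leqnn _) uu' (ltnW (aboveP _ _ vR _ u'R)).
Qed.

Lemma meets_nbrs v R s C : above v R -> C \subset R ->
  (forall u, u \in R -> (s <= u)%N = ~~ prec u v) ->
  (lower_deg v C == 0%N) = ~~ meets [set u : 'I_n | (s <= u)%N] C.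
Proof.
move=> vR CR sP; rewrite lower_deg_eq0 ?(above_sub CR) // /meets negbK.
apply/forall_inP/eqP => [h|/setP h u uC].
  apply/setP => u; rewrite !inE; apply/negP => /andP[uC].
  by rewrite sP ?h // (subsetP CR).
by apply/negPn; rewrite -sP ?(subsetP CR) //; have := h u; rewrite !inE uC /= => ->.
Qed.

Lemma subr_negb (A : nzRingType) (b : bool) : 1 - (~~ b)%:R = b%:R :> A.
Proof. by case: b; rewrite ?subr0 ?subrr. Qed.

Lemma npoly_peel_meets R t :
  (forall u v, u \in R -> v \in R -> (t <= u)%N -> (t <= v)%N -> ~~ prec u v) ->
  npoly (peel_sum (fun C => (meets [set u : 'I_n | (t <= u)%N] C)%:R) R).
Proof.
elim/set_above_ind: R t => [|v R vR IH] t clq.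
  by rewrite peel_sum0; apply: (npoly_nat 0).
set D := [set u : 'I_n | _].
have clqR u u' : u \in R -> u' \in R -> (t <= u)%N -> (t <= u')%N -> ~~ prec u u'.
  by move=> uR u'R; apply: clq; rewrite inE ?uR ?u'R orbT.
have [tv|tv] := leqP t v; last first.
  rewrite peel_sum_eq0; first exact: (npoly_nat 0).
  move=> C /subsetP CR _; rewrite /meets; case: set0Pn => // -[u].
  rewrite !inE => /andP[/CR/setU1P[->|/(aboveP _ _ vR) uv] tu].
    by rewrite leqNgt tv in tu.
  by move: (leq_ltn_trans tu uv); rewrite ltnNge ltnW.
rewrite peel_sumU1 //.
have vD : meets D [set v] by apply/set0Pn; exists v; rewrite !inE eqxx.
rewrite vD mul1r.
have -> : peel_sum (fun C => (lower_deg v C == 0%N)%:R *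
    ((meets D C)%:R - (meets D (v |: C))%:R)) R
  = - peel_sum (fun C => (lower_deg v C == 0%N)%:R) R.
  rewrite -peel_sumN; apply: eq_peel_sum => C CR _.
  have -> : meets D (v |: C) by apply/set0Pn; exists v; rewrite !inE eqxx.
  case e: (lower_deg v C == 0%N); rewrite ?mul0r ?oppr0 // mul1r.
  case: (boolP (meets D C)) => [/set0Pn[u]|_]; last by rewrite sub0r.
  rewrite !inE => /andP[uC tu]; exfalso.
  move: e; rewrite lower_deg_eq0 ?(above_sub CR) // => /forall_inP/(_ u uC).
  by apply/negP; apply: clq => //; rewrite ?setU11 // inE (subsetP CR _ uC) orbT.
rewrite addrAC; apply: npolyD; last first.
  by apply: npolyM; [apply: npolyM; [apply: (npolyXn 1)|apply: npoly_qint]|apply: IH].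
have [->|R0] := eqVneq R set0.
  by rewrite peel_sum0 oppr0 addr0; apply: npoly_orientations.
rewrite peel_orientations (negbTE R0) add0r -peel_sumN -peel_sumD.
have [s sP] := nbrs_threshold vR.
rewrite (@eq_peel_sum _ (fun C => (meets [set u : 'I_n | (s <= u)%N] C)%:R)).
  by apply: IH ; apply: (nbrs_clique vR sP).
by move=> C CR _; rewrite (meets_nbrs vR CR sP) subr_negb.
Qed.

Lemma npoly_peel_card R : npoly (peel_sum (fun C => #|C|%:R) R).
Proof.
elim/set_above_ind: R => [|v R vR IH].
  by rewrite peel_sum0; apply: (npoly_nat 0).
rewrite peel_sumU1 // cards1 mul1r.
rewrite (@eq_peel_sum (fun C => _ * _) (fun C => - (lower_deg v C == 0%N)%:R)); last first.
  move=> C CR _; rewrite cardsU1 (above_notin (above_sub CR vR)) natrD.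
  by case: eqP; rewrite ?mul0r ?oppr0 // mul1r => _; rewrite opprD addrCA subrr addr0.
rewrite peel_sumN addrAC; apply: npolyD; last first.
  by apply: npolyM; [apply: npolyM; [apply: (npolyXn 1)|apply: npoly_qint]|].
have [->|R0] := eqVneq R set0.
  by rewrite peel_sum0 oppr0 addr0; apply: npoly_orientations.
rewrite peel_orientations (negbTE R0) add0r -peel_sumN -peel_sumD.
have [s sP] := nbrs_threshold vR.
rewrite (@eq_peel_sum _ (fun C => (meets [set u : 'I_n | (s <= u)%N] C)%:R)).
  by apply: npoly_peel_meets ; apply: (nbrs_clique vR sP).
by move=> C CR _; rewrite (meets_nbrs vR CR sP) subr_negb.
Qed.

(* The coefficient of x^al in the chromatic function of the graph on [R], by
   choosing the colour classes one after the other. *)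
Fixpoint chrom_coef R (al : seq nat) : {poly int} :=
  if al is a :: al' then
    \sum_(C : {set 'I_n} | [&& C \subset R, chain C & #|C| == a])
       'X^(ascs C (R :\: C)) * chrom_coef (R :\: C) al'
  else (R == set0)%:R.

Lemma head_sum_chrom h K j R : (n <= K)%N -> (#|R| <= j.+1)%N ->
  (forall R', (#|R'| <= j)%N ->
    alt_sum K j (chrom_coef R') = orientations R') ->
  head_sum h K j (chrom_coef R) = peel_sum (fun C => h #|C|) R.
Proof.
move=> nK Rj IH; rewrite /head_sum.
pose F C := 'X^(ascs C (R :\: C)) * orientations (R :\: C).
pose G a := (-1) ^+ a.+1 * h a.
transitivity (\sum_(a < K) G a.+1 *
    \sum_(C : {set 'I_n} | [&& C \subset R & chain C] && (#|C| == a.+1)) F C).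
  apply: eq_bigr => a _; rewrite /G exprS exprS !mulN1r opprK; congr (_ * _).
  rewrite (@alt_sum_linear _ _ _ (fun C => 'X^(ascs C (R :\: C))) _ _
            (fun C => chrom_coef (R :\: C)) _ (fun=> erefl)) /=.
  apply: eq_big => [C|C /and3P[CR _ /eqP cC]]; first by rewrite andbA.
  rewrite IH // -ltnS (leq_trans _ Rj) // cardsD (setIidPr CR) cC.
  have := subset_leq_card CR; rewrite cC => h1; rewrite ltn_subrL /=.
  exact: leq_trans h1.
rewrite sum_card_classes ?card_ord // /peel_sum big_mkcond [RHS]big_mkcond /=.
apply: eq_bigr => C _; rewrite /peel_term /G /F.
case: (C \subset R) => //=; rewrite andbC.
by case: ifP => // _; rewrite !mulrA.
Qed.

Lemma alt_sum_chrom K j R : (n <= K)%N -> (#|R| <= j)%N ->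
  alt_sum K j (chrom_coef R) = orientations R.
Proof.
move=> nK; elim: j R => [|j IH] R Rj.
  move: Rj; rewrite leqn0 cards_eq0 => /eqP ->.
  by rewrite /= eqxx addr0 orientations0.
by rewrite alt_sumS (head_sum_chrom _ nK Rj) // [RHS]peel_orientations.
Qed.

Lemma npoly_chrom_coef R al : npoly (chrom_coef R al).
Proof.
elim: al R => [|a al IH] R /=; first exact: npoly_nat.
by apply: npoly_sum => C _; apply: npolyM; [apply: npolyXn|].
Qed.

Lemma npoly_head_sum_chrom K j be R : (n <= K)%N -> (n <= j.+1)%N ->
  npoly (head_sum (fun a => a%:R) K j (fun al => chrom_coef R (be ++ al))).
Proof.
move=> nK nj; elim: be R => [|b be IH] R /=.
  rewrite head_sum_chrom //; first exact: npoly_peel_card.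
    by apply: leq_trans nj; rewrite -[n in (_ <= n)%N]card_ord max_card.
  by move=> R'; apply: alt_sum_chrom.
rewrite (@head_sum_linear _ _ _ _ _ _ _ 
  (fun C al => chrom_coef (R :\: C) (be ++ al)) _ (fun=> erefl)).
by apply: npoly_sum => C _; apply: npolyM; [apply: npolyXn|].
Qed.

(** * Symmetry *)

Section TwoColors.

Implicit Types x y : {poly {poly int}}.

Definition two_coloring x y R C : {poly {poly int}} :=
  if chain C && chain (R :\: C) then
    ('X^(ascs C (R :\: C)))%:P * x ^+ #|C| * y ^+ #|R :\: C|
  else 0.

Definition top_in v x y R :=
  \sum_(C : {set 'I_n} | C \subset R) (v \in C)%:R * two_coloring x y R C.

Definition top_out v x y R :=
  \sum_(C : {set 'I_n} | C \subset R) (v \notin C)%:R * two_coloring x y R C.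

Lemma top_inU1 v x y R : above v R ->
  top_in v x y (v |: R) = x * \sum_(C : {set 'I_n} | C \subset R)
    (lower_deg v C == 0%N)%:R * two_coloring x y R C.
Proof.
move=> vR; have vnR := above_notin vR.
rewrite /top_in sum_subsetU1 // mulr_sumr; apply: eq_bigr => C CR.
have vC := above_sub CR vR; rewrite setU11 (negbTE (above_notin vC)) mul0r add0r mul1r.
rewrite /two_coloring setU1DU1 // chainU1 // cardsU1 above_notin //=.
rewrite ascsU1l ?above_notin //; last by apply: above_sub vR; rewrite subsetDl.
case: (chain C) => /=; last by rewrite !mulr0.
case: (_ == _) => /=; last by rewrite mul0r mulr0.
case: ifP => _; rewrite ?mulr0 // mul1r add1n exprS.
by set a := polyC _; set b := x ^+ _; set c := y ^+ _; ring.
Qed.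

Lemma top_outU1 v x y R : above v R ->
  top_out v x y (v |: R) = y * \sum_(C : {set 'I_n} | C \subset R)
    (lower_deg v (R :\: C) == 0%N)%:R * ('X^(lower_deg v C))%:P *
    two_coloring x y R C.
Proof.
move=> vR; have vnR := above_notin vR.
rewrite /top_out sum_subsetU1 // mulr_sumr; apply: eq_bigr => C CR.
have vC := above_sub CR vR; rewrite setU11 (above_notin vC) mul0r addr0 mul1r.
have vD : above v (R :\: C) by apply: above_sub vR; rewrite subsetDl.
rewrite /two_coloring setU1D ?above_notin // chainU1 // cardsU1 above_notin //=.
rewrite ascsU1r ?above_notin //.
case: (chain C) => /=; last by rewrite !mulr0.
rewrite andbC; case: (_ == _) => /=; last by rewrite !mul0r mulr0.
case: ifP => _; rewrite ?mulr0 // mul1r add1n exprS exprD polyCM.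
by set a := polyC _; set b := polyC _; set c := x ^+ _; set d := y ^+ _; ring.
Qed.

Lemma top_in_out v x y R :
  top_in v x y R + top_out v x y R =
  \sum_(C : {set 'I_n} | C \subset R) two_coloring x y R C.
Proof.
rewrite -big_split; apply: eq_bigr => C _ /=.
by case: (v \in C); rewrite mul1r mul0r ?addr0 ?add0r.
Qed.

(* The graph induced on the vertices of two colours is a union of increasing
   paths; [T] collects all but the end of the path that contains the top vertex
   [v]. The two cases are those of an odd and of an even path. *)
Lemma two_coloring_top R : R != set0 ->
  exists v, [/\ v \in R, above v (R :\ v) &
  exists2 T, (forall x y, T x y = T y x) &
    (forall x y, top_in v x y R = x * T x y /\ top_out v x y R = y * T x y) \/
    (forall x y, top_in v x y R = T x y /\ top_out v x y R = 'X%:P * T x y)].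
Proof.
elim/set_above_ind: R => [|v R vR IH]; first by rewrite eqxx.
move=> _.
exists v; rewrite setU11 setU1K ?above_notin //; split=> //.
have [R0|/IH[w [wR wtop [T Tsym Tform]]]] := eqVneq R set0.
  exists (fun _ _ => 1) => //; left => x y; rewrite top_inU1 // top_outU1 //.
  rewrite R0 !(big_pred1 set0); try by move=> C; rewrite subset0.
  by rewrite /two_coloring setD0 chain0 lower_deg0 eqxx ascs0l cards0 /= !mulr1.
have wv := aboveP _ _ vR _ wR.
have top u : u \in R -> u != w -> (u < w)%N.
  by move=> uR uw; apply: (aboveP _ _ wtop); rewrite !inE uw.
have [pwv|nwv] := boolP (prec w v).
  have lv0 C : C \subset R -> lower_deg v C = 0%N.
    move=> CR; apply/eqP; rewrite lower_deg_eq0 ?(above_sub CR) //.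
    apply/forall_inP => u /(subsetP CR) uR; have [->//|uw] := eqVneq u w.
    by apply: prec_mono pwv (leqnn _); rewrite ltnW ?top.
  exists (fun x y => top_in w x y R + top_out w x y R) => [x y|].
    by case: Tform => h; rewrite !(h x y).1 !(h x y).2 !(h y x).1 !(h y x).2 (Tsym x y) // addrC.
  left => x y; rewrite top_inU1 // top_outU1 // top_in_out.
  split; congr (_ * _); apply: eq_bigr => C CR; rewrite ?(lv0 _ (subsetDl R C)) ?(lv0 C CR) eqxx ?mul1r //.
have [/exists_inP[u uR /andP[uw nuv]]|] :=
    boolP [exists u in R, (u != w) && ~~ prec u v].
  have nuw : ~~ prec u w.
    by apply: contra nuv => puw; apply: prec_mono (leqnn _) puw (ltnW wv).
  have nchain C : u \in C -> w \in C -> chain C = false.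
    by move=> uC wC; apply/negbTE/chainP => /(_ u w uC wC (top u uR uw)); apply/negP.
  have ldeg C z : C \subset R -> z \in C -> ~~ prec z v -> (lower_deg v C == 0%N) = false.
    move=> CR zC nzv; rewrite lower_deg_eq0 ?(above_sub CR) //.
    by apply/negbTE/forall_inP => /(_ z zC); apply/negP.
  exists (fun _ _ => 0) => //; left => x y; rewrite top_inU1 // top_outU1 //.
  rewrite !mulr0 !big1 ?mulr0 // => C CR.
    have [wC|wC] := boolP (w \in C); last first.
      by rewrite (ldeg _ w) ?mul0r ?subsetDl // inE wC.
    have [uC|uC] := boolP (u \in C); last first.
      by rewrite (ldeg _ u) ?mul0r ?subsetDl // inE uC.
    by rewrite /two_coloring nchain // mulr0.
  have [wC|wC] := boolP (w \in C); first by rewrite (ldeg _ w) ?mul0r.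
  have [uC|uC] := boolP (u \in C); first by rewrite (ldeg _ u) ?mul0r.
  by rewrite /two_coloring andbC nchain ?inE ?wC ?uC //= mulr0.
rewrite negb_exists_in => /forall_inP onlyw.
have ldeg C : C \subset R -> lower_deg v C = (w \in C).
  move=> CR; have E u : u \in C -> adj_lt u v = (u == w).
    move=> uC; have uR := subsetP CR u uC; rewrite /adj_lt (aboveP _ _ vR) //=.
    have [->|uw] := eqVneq u w; first by rewrite nwv.
    by have := onlyw u uR; rewrite uw /= negbK => ->.
  rewrite /lower_deg; have [wC|wC] := boolP (w \in C).
    rewrite (bigD1 w) //= E // eqxx big1 // => u /andP[uC /negbTE uw].
    by rewrite E // uw.
  by rewrite big1 // => u uC; rewrite E //; case: eqP => // uw; rewrite -uw uC in wC.
have Ein x y : top_in v x y (v |: R) = x * top_out w x y R.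
  rewrite top_inU1 //; congr (_ * _); apply: eq_bigr => C CR.
  by rewrite ldeg // eqb0.
have Eout x y : top_out v x y (v |: R) = y * ('X%:P * top_in w x y R).
  rewrite top_outU1 //; congr (_ * _); rewrite mulr_sumr; apply: eq_bigr => C CR.
  rewrite !ldeg ?subsetDl // inE wR andbT eqb0 negbK.
  by case: (w \in C); rewrite ?mul0r ?mulr0 // !mul1r.
case: Tform => h.
  exists (fun x y => x * (y * T x y)) => [x y|]; first by rewrite Tsym mulrCA.
  right => x y; rewrite Ein Eout (h x y).1 (h x y).2; split=> //.
  by rewrite mulrCA; congr (_ * _); rewrite mulrCA.
exists (fun x y => 'X%:P * T x y) => [x y|]; first by rewrite Tsym.
by left => x y; rewrite Ein Eout (h x y).1 (h x y).2.
Qed.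

Lemma two_coloring_sym x y R :
  \sum_(C : {set 'I_n} | C \subset R) two_coloring x y R C =
  \sum_(C : {set 'I_n} | C \subset R) two_coloring y x R C.
Proof.
have [->|/two_coloring_top[v [_ _ [T Tsym h]]]] := eqVneq R set0.
  apply: eq_bigr => C; rewrite subset0 => /eqP ->.
  by rewrite /two_coloring setD0 cards0.
rewrite -!(top_in_out v).
by case: h => h; rewrite !(h x y).1 !(h x y).2 !(h y x).1 !(h y x).2 (Tsym x y) // addrC.
Qed.

Lemma chain_split_sym R a :
  \sum_(C : {set 'I_n} | [&& C \subset R, chain C, chain (R :\: C) & #|C| == a])
     'X^(ascs C (R :\: C)) =
  \sum_(C : {set 'I_n} | [&& C \subset R, chain C, chain (R :\: C) & #|R :\: C| == a])
     'X^(ascs C (R :\: C)) :> {poly int}.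
Proof.
have /(congr1 (fun p : {poly {poly int}} => p`_a)) := two_coloring_sym 'X 1 R.
have E C (b : nat) : (('X^(ascs C (R :\: C)))%:P * 'X^b : {poly {poly int}})`_a =
    if b == a then 'X^(ascs C (R :\: C)) else 0.
  by rewrite coefCM coefXn eq_sym; case: eqP; rewrite ?mulr1 ?mulr0.
rewrite !coef_sum /two_coloring => h.
rewrite big_mkcond [RHS]big_mkcond in h; rewrite big_mkcond [RHS]big_mkcond /=.
apply: etrans (etrans _ h) _; apply: eq_bigr => C _; case: (C \subset R) => //=;
  rewrite -?andbA; case: (chain C) => //=; rewrite ?coef0 //; case: (chain _) => //=;
  rewrite ?coef0 // expr1n mulr1.
  by rewrite E.
by rewrite E.
Qed.

End TwoColors.

Lemma setUD C U : C :|: U :\: C = C :|: U.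
Proof. by apply/setP => u; rewrite !inE; case: (u \in C). Qed.

Lemma chrom_coef2 R a b al :
  chrom_coef R [:: a, b & al] =
  \sum_(U : {set 'I_n} | (U \subset R) && (#|U| == a + b)%N)
    (\sum_(C : {set 'I_n} | [&& C \subset U, chain C, chain (U :\: C) & #|C| == a])
       'X^(ascs C (U :\: C))) *
    ('X^(ascs U (R :\: U)) * chrom_coef (R :\: U) al).
Proof.
rewrite /=.
under [RHS]eq_bigr => U _ do rewrite mulr_suml.
rewrite [RHS](exchange_big_dep
  (fun C : {set 'I_n} => [&& C \subset R, chain C & #|C| == a])) /=; last first.
  by move=> U C /andP[UR _] /and4P[CU -> _ ->]; rewrite (subset_trans CU).
apply: eq_bigr => C /and3P[CR chC /eqP cC]; rewrite mulr_sumr.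
rewrite (reindex_onto (fun U => U :\: C) (fun D => C :|: D)) /=; last first.
  move=> D /andP[/subsetP DR _]; apply/setP => u; rewrite !inE.
  by have := DR u; rewrite !inE; case: (u \in D) => [/(_ isT)/andP[->]|_]; rewrite ?orbT ?orbF ?andNb.
apply: eq_big => [U|U /andP[/and3P[UCR chUC cUC] /eqP CU]].
  rewrite chC cC eqxx andbT /=.
  have -> : (C :|: U :\: C == U) = (C \subset U).
    by rewrite setUD; apply/eqP/setUidPr.
  have [CU|] := boolP (C \subset U); last by rewrite !andbF.
  rewrite !andbT; have -> : (U :\: C \subset R :\: C) = (U \subset R).
    apply/idP/idP => [UR|UR]; last exact: setSD.
    apply/subsetP => u uU; have [/(subsetP CR)//|uC] := boolP (u \in C).
    by have := subsetP UR u; rewrite !inE uU uC => /(_ isT).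
  have := cardsD U C; rewrite (setIidPr CU) cC => ->.
  have := subset_leq_card CU; rewrite cC => aU.
  by rewrite -(eqn_add2l a) subnKC // andbA andbAC.
have CsU : C \subset U by rewrite -CU subsetUl.
have UR : U \subset R.
  by rewrite -CU subUset CR (subset_trans UCR) // subsetDl.
have dCU : R :\: C = (U :\: C) :|: (R :\: U).
  apply/setP => u; rewrite !inE; have := subsetP CsU u; have := subsetP UR u.
  by case: (u \in C); case: (u \in U); case: (u \in R) => //= h1 h2;
    rewrite ?(h1 isT) ?(h2 isT).
have dRU : (R :\: C) :\: (U :\: C) = R :\: U.
  apply/setP => u; rewrite !inE; have := subsetP CsU u.
  by case: (u \in C); case: (u \in U) => //= /(_ isT).
rewrite dRU dCU ascsUr; last first.
  by rewrite -setI_eq0; apply/eqP/setP => u; rewrite !inE; case: (u \in U); rewrite ?andbF.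
have -> : ascs U (R :\: U) = (ascs C (R :\: U) + ascs (U :\: C) (R :\: U))%N.
  rewrite -ascsUl ?setUD ?(setUidPr CsU) //.
  by rewrite -setI_eq0; apply/eqP/setP => u; rewrite !inE; case: (u \in C).
by rewrite !exprD !mulrA.
Qed.

Lemma chrom_coef_swap R a b al :
  chrom_coef R [:: a, b & al] = chrom_coef R [:: b, a & al].
Proof.
rewrite !chrom_coef2 addnC; apply: eq_bigr => U /andP[_ /eqP cU]; congr (_ * _).
rewrite chain_split_sym; apply: eq_bigl => C.
have [CU|] := boolP (C \subset U) => //=; do 2 congr (_ && _).
have := subset_leq_card CU; have := cardsD U C; rewrite (setIidPr CU) cU => -> h.
by apply/idP/idP => /eqP e; apply/eqP; move: h e; move: #|C| => k; lia.
Qed.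

Lemma chrom_coef_zero R al : chrom_coef R (0%N :: al) = chrom_coef R al.
Proof.
rewrite /= (big_pred1 set0) => [|C]; first by rewrite ascs0l setD0 mul1r.
rewrite /= cards_eq0; case: eqP => [->|]; last by rewrite !andbF.
by rewrite sub0set chain0.
Qed.

Lemma chrom_coef_degree R al : sumn al != #|R| -> chrom_coef R al = 0.
Proof.
elim: al R => [|a al IH] R /=.
  by rewrite eq_sym cards_eq0 => /negbTE ->.
move=> ne; apply: big1 => C /and3P[CR _ /eqP cC]; rewrite IH ?mulr0 //.
apply: contraNneq ne => ->; rewrite cardsD (setIidPr CR) cC subnKC //.
by rewrite -cC subset_leq_card.
Qed.

(** * Coefficients of chromatic and elementary functions *)

Section ColoringClasses.

Variables (N : nat) (m : 'X_{1..N}).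
Implicit Types (kappa : {ffun 'I_n -> 'I_N}) (base : 'I_n -> nat).

Definition color_class kappa (i : nat) : {set 'I_n} := [set v | kappa v == i :> nat].

Definition color_above kappa (i : nat) : {set 'I_n} := [set v | (i < kappa v)%N].

Definition class_term kappa i : {poly int} :=
  (chain (color_class kappa i) && (#|color_class kappa i| == nth 0%N m i))%:R *
  'X^(ascs (color_class kappa i) (color_above kappa i)).

Definition extends base R j kappa :=
  [forall v, if v \in R then (j <= kappa v)%N else kappa v == base v :> nat].

Lemma extend_colors_full base : (forall v, (base v < N)%N) ->
  \sum_(kappa | extends base set0 N kappa)
     \prod_(i < N | (N <= i)%N) class_term kappa i = 1.
Proof.
move=> h0; pose kappa1 := [ffun v => Ordinal (h0 v)].
rewrite (big_pred1 kappa1).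
  by rewrite big_pred0 // => i; rewrite leqNgt ltn_ord.
move=> kappa; apply/forallP/eqP => [h|-> v]; last by rewrite inE ffunE.
by apply/ffunP => v; apply/val_inj; have := h v; rewrite inE ffunE => /eqP.
Qed.

Lemma extends_peel base R j (jN : (j < N)%N) (C : {set 'I_n}) kappa :
  C \subset R ->
  extends base R j kappa && ([set v in R | kappa v == j :> nat] == C) =
  extends (fun v => if v \in C then j else base v) (R :\: C) j.+1 kappa.
Proof.
move=> CR; apply/andP/forallP => [[/forallP h /eqP eC] v|h].
  have := h v; rewrite -eC !inE; case: (v \in R) => //=.
  by rewrite andbT; have [->|ne] := eqVneq (kappa v : nat) j; rewrite ?eqxx //= ltn_neqAle eq_sym ne.
split.
  apply/forallP => v; have := h v; rewrite !inE; have := subsetP CR v.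
  case: (v \in C) => /= [/(_ isT) -> |_]; first by move/eqP ->.
  by case: (v \in R) => //; apply: ltnW.
apply/eqP/setP => v; have := h v; rewrite !inE; have := subsetP CR v.
case: (v \in C) => /= [/(_ isT) -> |_] //=; case: (v \in R) => //=.
by rewrite ltn_neqAle eq_sym => /andP[/negbTE].
Qed.

Lemma extend_colors j base R : (j <= N)%N ->
  (forall v, v \notin R -> (base v < j)%N) ->
  \sum_(kappa | extends base R j kappa)
     \prod_(i < N | (j <= i)%N) class_term kappa i = chrom_coef R (drop j m).
Proof.
move=> jN; move: (subnK jN); move: (N - j)%N => k.
elim: k j jN base R => [|k IH] j jN base R ek h0.
  have -> : j = N by rewrite -ek.
  rewrite drop_oversize ?size_tuple //=.
  have [R0|/set0Pn[v vR]] := eqVneq R set0.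
    rewrite R0 extend_colors_full // => v; rewrite -ek; apply: h0.
    by rewrite R0 inE.
  rewrite big_pred0 // => kappa; apply/negbTE/negP => /forallP/(_ v).
  by rewrite vR leqNgt ltn_ord.
have {}jN : (j < N)%N by rewrite -ek addSn ltnS leq_addl.
rewrite (drop_nth 0%N) ?size_tuple //=.
rewrite (partition_big (fun kappa => [set v in R | kappa v == j :> nat])
   (fun C => C \subset R)) /=; last first.
  by move=> kappa _; apply/subsetP => v; rewrite inE => /andP[].
rewrite [RHS]big_mkcond [LHS]big_mkcond; apply: eq_bigr => C _ /=.
case CR: (C \subset R) => //=.
under eq_bigl => kappa do rewrite extends_peel //.
rewrite -(IH j.+1 jN (fun v => if v \in C then j else base v)); first last.
- move=> v; rewrite !inE; case: (v \in C) => //= vR.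
  by rewrite ltnS ltnW // h0.
- by rewrite addnS.
set Fj := 'X^_; rewrite -/Fj.
transitivity (\sum_(kappa | extends (fun v => if v \in C then j else base v)
    (R :\: C) j.+1 kappa)
    (chain C && (#|C| == nth 0%N m j))%:R * Fj *
      \prod_(i < N | (j.+1 <= i)%N) class_term kappa i).
  apply: eq_bigr => kappa /forallP h.
  rewrite (bigD1 (Ordinal jN)) //=; congr (_ * _); last first.
    by apply: eq_bigl => i; rewrite -val_eqE /= [RHS]ltn_neqAle eq_sym andbC.
  have h' v : (kappa v == j :> nat) = (v \in C) /\ (j < kappa v)%N = (v \in R :\: C).
    have := h v; rewrite !inE; have := subsetP CR v.
    case: (v \in C) => /= [/(_ isT) _ /eqP ->|_]; first by rewrite eqxx ltnn.
    case: (boolP (v \in R)) => [_|vR /eqP ->]; first by rewrite ltn_neqAle eq_sym => /andP[/negbTE-> ->].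
    by have := h0 v vR; rewrite ltn_neqAle leqNgt => /andP[/negbTE-> /negbTE->].
  rewrite /class_term; have -> : color_class kappa j = C.
    by apply/setP => v; rewrite inE; case: (h' v).
  by have -> : color_above kappa j = R :\: C by apply/setP => v; rewrite inE; case: (h' v).
rewrite -mulr_sumr; case: ifP => _; first by rewrite mul1r.
by rewrite !mul0r.
Qed.

End ColoringClasses.

Lemma prod_natr_bool (I : finType) (A : comNzRingType) (b : pred I) :
  \prod_i (b i)%:R = [forall i, b i]%:R :> A.
Proof.
have [/forallP h|] := boolP [forall i, b i].
  by rewrite big1 // => i _; rewrite h.
by rewrite negb_forall => /existsP[i /negbTE bi]; rewrite (bigD1 i) //= bi mul0r.
Qed.

Lemma inc_graph_lt u v : inc_graph prec u v && (u < v)%N = adj_lt u v.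
Proof.
rewrite /inc_graph /adj_lt; case: (ltngtP u v) => uv; rewrite ?andbF //= andbT.
have -> : prec v u = false.
  by apply/negP => /prec_lt; rewrite ltnNge ltnW.
by rewrite andbT -val_eqE /= ltn_eqF.
Qed.

Lemma inc_graphC u v : inc_graph prec u v = inc_graph prec v u.
Proof. by rewrite /inc_graph eq_sym; congr (_ && _); rewrite andbC. Qed.

Lemma inc_graph_proper N (kappa : {ffun 'I_n -> 'I_N}) :
  proper_coloring (inc_graph prec) kappa =
  [forall i : 'I_N, chain (color_class kappa i)].
Proof.
apply/forallP/forallP => h.
  move=> i; apply/chainP => u v; rewrite !inE => /eqP ku /eqP kv uv.
  have := forallP (h u) v; rewrite -(inj_eq val_inj) /= ku kv eqxx implybF.
  by apply: contraNT => nuv; move: (inc_graph_lt u v); rewrite uv andbT /adj_lt uv nuv.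
move=> u; apply/forallP => v; apply/implyP.
have key (x y : 'I_n) : (x < y)%N -> inc_graph prec x y -> kappa x != kappa y.
  move=> xy ixy; apply/eqP => exy.
  have : prec x y by apply: (chainP _ (h (kappa x))) => //; rewrite inE ?exy.
  by move: (inc_graph_lt x y); rewrite ixy xy /adj_lt xy /= => /esym/negP.
case: (ltngtP u v) => [uv|vu|/val_inj <-]; first exact: key.
  by rewrite inc_graphC eq_sym; apply: key.
by rewrite /inc_graph eqxx.
Qed.

Lemma inc_graph_asc N (kappa : {ffun 'I_n -> 'I_N}) :
  asc (inc_graph prec) kappa =
  (\sum_(i < N) ascs (color_class kappa i) (color_above kappa i))%N.
Proof.
rewrite /asc -sum1_card big_set /= (partition_big (fun p => kappa p.1) xpredT) //=.
apply: eq_bigr => i _; rewrite /ascs pair_big /=.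
rewrite big_mkcond [RHS]big_mkcond; apply: eq_bigr => -[u v] _ /=.
rewrite unfold_in /= !inE -inc_graph_lt (_ : (kappa u == i) = (kappa u == i :> nat)) //.
have [->|_] /= := eqVneq (kappa u : nat) i; last by rewrite andbF.
by rewrite andbT andbA; case: (_ && (u < v)%N); case: (i < _)%N.
Qed.

Lemma mcoeff_chrom_qsym N (m : 'X_{1..N}) :
  (chrom_qsym N (inc_graph prec))@_m = chrom_coef setT m.
Proof.
rewrite -[m : seq nat]drop0 -(@extend_colors N m 0 (fun=> 0%N)) //; last first.
  by move=> v; rewrite inE.
rewrite /chrom_qsym raddf_sum /= big_mkcond [RHS]big_mkcond.
apply: eq_bigr => kappa _.
have -> : extends (fun=> 0%N) setT 0 kappa by apply/forallP => v; rewrite inE.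
rewrite big_split /= prodrXr inc_graph_proper inc_graph_asc prod_natr_bool.
rewrite mcoeffZ mprodXE mcoeffX.
have E i : (\sum_(v < n) U_(kappa v))%MM i = #|color_class kappa i|.
  rewrite mnm_sumE -sum1_card [RHS]big_mkcond; apply: eq_bigr => v _.
  by rewrite mnm1E inE -val_eqE; case: eqP.
have -> : ((\sum_(v < n) U_(kappa v))%MM == m) =
    [forall i : 'I_N, #|color_class kappa i| == nth 0%N m i].
  apply/eqP/forallP => [<- i|h]; first by rewrite -mnm_nth E.
  by apply/mnmP => i; rewrite E (eqP (h i)) -mnm_nth.
have [/forallP ch|nch] := boolP [forall i : 'I_N, chain (color_class kappa i)].
  rewrite /= mulrC; congr (_ * _); congr (_%:R); congr (nat_of_bool _).
  by apply: eq_forallb => i; rewrite ch.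
rewrite (_ : [forall i, _] = false) ?mul0r //.
by apply: contraNF nch => /forallP h; apply/forallP => i; case/andP: (h i).
Qed.

End UnitInterval.

Section Elementary.

Variable s : nat.
Implicit Types (lam : {ffun 'I_s -> nat}) (S T : {set 'I_s}).

Definition support lam := [set i | 0 < lam i]%N.

Definition lower lam S : {ffun 'I_s -> nat} := [ffun i => lam i - (i \in S)]%N.

(* The coefficient of x^al in the product of the e_(lam i): the variable x_j is
   taken from the factors in a set of size al_j. *)
Fixpoint elem_coef lam (al : seq nat) : {poly int} :=
  if al is a :: al' then
    \sum_(S : {set 'I_s} | (S \subset support lam) && (#|S| == a))
       elem_coef (lower lam S) al'
  else (support lam == set0)%:R.

Lemma sum_lower lam S : S \subset support lam ->
  (\sum_i lower lam S i + #|S| = \sum_i lam i)%N.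
Proof.
move=> /subsetP SL; rewrite -sum1_card [X in (_ + X)%N]big_mkcond -big_split /=.
apply: eq_bigr => i _; rewrite ffunE; case: ifP => iS; rewrite ?addn0 ?subn0 //.
by rewrite subnK //; have := SL i iS; rewrite inE.
Qed.

Lemma sum_eq0 lam : (support lam == set0) = (\sum_i lam i == 0)%N.
Proof.
rewrite sum_nat_eq0; apply/eqP/forallP => [h i|h].
  by move/setP: h => /(_ i); rewrite !inE lt0n => /negbFE.
by apply/setP => i; rewrite !inE (eqP (h i)).
Qed.

Lemma sum_sign T :
  \sum_(S : {set 'I_s} | S \subset T) (-1) ^+ #|S| = (T == set0)%:R :> {poly int}.
Proof.
have [->|/set0Pn[x xT]] := eqVneq T set0.
  by rewrite (big_pred1 set0) ?cards0 // => S; rewrite /= subset0.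
rewrite -(setD1K xT) sum_subsetU1 ?setD11 //; apply: big1 => S SD.
have xS : x \notin S by apply/negP => /(subsetP SD); rewrite !inE eqxx.
by rewrite cardsU1 xS exprS mulN1r subrr.
Qed.

Lemma sum_sign_card T :
  \sum_(S : {set 'I_s} | S \subset T) (-1) ^+ #|S| * #|S|%:R
    = - (#|T| == 1)%:R :> {poly int}.
Proof.
have [->|/set0Pn[x xT]] := eqVneq T set0.
  rewrite (big_pred1 set0) ?cards0 ?mulr0 ?oppr0 // => S; by rewrite /= subset0.
rewrite -(setD1K xT) sum_subsetU1 ?setD11 // cardsU1 setD11 eqSS cards_eq0.
rewrite -sum_sign -sumrN; apply: eq_bigr => S SD.
have xS : x \notin S by apply/negP => /(subsetP SD); rewrite !inE eqxx.
by rewrite cardsU1 xS add1n exprS mulN1r -natr1 mulNr mulrDr mulr1 opprD addNKr.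
Qed.

Lemma head_sum_elem h K j lam : (s <= K)%N -> (\sum_i lam i <= j.+1)%N ->
  (forall lam', (\sum_i lam' i <= j)%N -> alt_sum K j (elem_coef lam') = 1) ->
  head_sum h K j (elem_coef lam) =
  \sum_(S : {set 'I_s} | (S \subset support lam) && (S != set0))
    - ((-1) ^+ #|S| * h #|S|).
Proof.
move=> sK lj IH; rewrite /head_sum.
pose G a := - ((-1) ^+ a * h a).
transitivity (\sum_(a < K) G a.+1 *
    \sum_(S : {set 'I_s} | (S \subset support lam) && (#|S| == a.+1)) 1).
  apply: eq_bigr => a _; have -> : G a.+1 = (-1) ^+ a * h a.+1.
    by rewrite /G exprS mulN1r mulNr opprK.
  congr (_ * _).
  rewrite (@alt_sum_linear _ (index_enum {set 'I_s})
    (fun S => (S \subset support lam) && (#|S| == a.+1)) (fun=> 1) _ _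
    (fun S => elem_coef (lower lam S))) => [|al] /=; last first.
    by apply: eq_bigr => S _; rewrite mul1r.
  apply: eq_bigr => S /andP[SL /eqP cS].
  rewrite mul1r IH // -ltnS (leq_trans _ lj) // -(sum_lower SL) cS addnS ltnS.
  exact: leq_addr.
rewrite sum_card_classes ?card_ord //.
by apply: eq_bigr => S _; rewrite mulr1.
Qed.

Lemma alt_sum_elem K j lam : (s <= K)%N -> (\sum_i lam i <= j)%N ->
  alt_sum K j (elem_coef lam) = 1.
Proof.
move=> sK; elim: j lam => [|j IH] lam lj.
  by move: lj; rewrite leqn0 -sum_eq0 /= => ->; rewrite addr0.
rewrite alt_sumS (head_sum_elem _ sK lj) // sumrN /=.
under eq_bigr => S _ do rewrite mulr1.
have := sum_sign (support lam); rewrite (bigD1 set0) ?sub0set //= cards0 expr0.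
by move=> <-; rewrite addrK.
Qed.

Lemma head_sum_card_elem K j lam : (s <= K)%N -> (\sum_i lam i <= j.+1)%N ->
  head_sum (fun a => a%:R) K j (elem_coef lam) = (#|support lam| == 1%N)%:R.
Proof.
move=> sK lj; rewrite head_sum_elem // => [|lam' lj']; last exact: alt_sum_elem.
have := sum_sign_card (support lam).
rewrite (bigD1 set0) ?sub0set //= cards0 mulr0 add0r => h.
by rewrite sumrN h opprK.
Qed.

Definition column lam j : nat := #|[set i | (j < lam i)%N]|.

Definition phi lam : nat := (\sum_i 'C(lam i, 2))%N.

Lemma sum_lower_split lam S :
  (\sum_i lower lam S i =
   \sum_(i in S) (lam i).-1 + \sum_(i in ~: S) lam i)%N.
Proof.
rewrite (bigID (mem S)) /=; congr (_ + _)%N.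
  by apply: eq_bigr => i iS; rewrite ffunE iS subn1.
apply: eq_big => [i|i iS]; first by rewrite inE.
by rewrite ffunE (negbTE iS) subn0.
Qed.

Lemma phi_lower lam S : (phi lam = phi (lower lam S) + \sum_(i in S) (lam i).-1)%N.
Proof.
rewrite /phi [X in (_ + X)%N]big_mkcond -big_split; apply: eq_bigr => i _ /=.
rewrite ffunE; case: ifP => _; rewrite ?subn0 ?addn0 // subn1.
by case: (lam i) => // k; rewrite binS bin1.
Qed.

Lemma column0 lam : column lam 0 = #|support lam|.
Proof. by []. Qed.

Lemma column_lower lam j : column (lower lam (support lam)) j = column lam j.+1.
Proof.
apply: eq_card => i; rewrite !inE ffunE inE.
by case: (lam i) => // k; rewrite subn1.
Qed.

End Elementary.

Fixpoint weight (al : seq nat) : nat :=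
  if al is _ :: al' then (weight al' + sumn al')%N else 0%N.

Section Triangularity.

Variable s : nat.
Implicit Types (lam : {ffun 'I_s -> nat}) (S : {set 'I_s}).

Lemma elem_coef_neq0 lam al : elem_coef lam al != 0 ->
  [/\ sumn al = (\sum_i lam i)%N, (phi lam <= weight al)%N &
      phi lam = weight al -> forall j, nth 0%N al j = column lam j].
Proof.
elim: al lam => [|a al IH] lam /=.
  rewrite sum_eq0; have [l0 _|_] := eqVneq (\sum_i lam i)%N 0%N; last by rewrite eqxx.
  have E i : lam i = 0%N.
    by apply/eqP; rewrite -leqn0 -l0 (bigD1 i) //= leq_addr.
  split=> //; first by rewrite /phi big1 // => i _; rewrite E.
  move=> _ j; rewrite nth_nil; apply/esym/eqP; rewrite cards_eq0.
  by apply/eqP/setP => i; rewrite !inE E.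
move=> nz; have [S /andP[SL /eqP cS]] : exists2 S : {set 'I_s},
    (S \subset support lam) && (#|S| == a) & elem_coef (lower lam S) al != 0.
  apply/exists_inP; apply: contraNT nz; rewrite negb_exists_in => /forall_inP h.
  by rewrite big1 // => S /h/negPn/eqP.
case/IH => sal wal eal.
have e1 := sum_lower SL; have e2 := sum_lower_split lam S; have e3 := phi_lower lam S.
split; [by rewrite -e1 cS sal addnC|by rewrite e3 sal e2 leq_add ?leq_addr|] => ew.
have [ephi eS] : phi (lower lam S) = weight al /\ (\sum_(i in ~: S) lam i = 0)%N.
  move: wal ew; rewrite e3 sal e2.
  move: (phi (lower lam S)) (weight al) (\sum_(i in S) _)%N => x y z.
  by move: (\sum_(i in ~: S) _)%N => t; lia.
have {}SL : S = support lam.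
  apply/eqP; rewrite eqEsubset SL; apply/subsetP => i; rewrite inE => li.
  apply/negPn/negP => iS; move: eS; rewrite (bigD1 i) ?inE //= => /eqP.
  by rewrite addn_eq0 eqn0Ngt li.
case=> [|j] /=; first by rewrite column0 -SL.
by rewrite eal // SL column_lower.
Qed.

Lemma elem_coef_head lam a al : elem_coef lam (a :: al) != 0 -> (a <= s)%N.
Proof.
rewrite leqNgt; apply: contraNN => sa /=; rewrite big1 // => S /andP[_ /eqP cS].
by move: (max_card (mem S)); rewrite cS card_ord leqNgt sa.
Qed.

Lemma elem_coef_column lam K : (forall i, lam i <= K)%N ->
  elem_coef lam (mkseq (column lam) K) = 1 /\
  weight (mkseq (column lam) K) = phi lam.
Proof.
elim: K lam => [|K IH] lam lK.
  have E i : lam i = 0%N by apply/eqP; rewrite -leqn0.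
  split; last by rewrite /= /phi big1 // => i _; rewrite E.
  by rewrite /= sum_eq0 big1 // => i _; rewrite E.
have [|e w] := IH (lower lam (support lam)).
  move=> i; rewrite ffunE inE; have := lK i; case: (lam i) => // k.
  by rewrite subn1.
have E : mkseq (column lam) K.+1 =
    #|support lam| :: mkseq (column (lower lam (support lam))) K.
  rewrite /mkseq /= (iotaDl 1 0) -map_comp; congr (_ :: _).
  by apply: eq_map => j /=; rewrite column_lower.
have nz : elem_coef (lower lam (support lam))
    (mkseq (column (lower lam (support lam))) K) != 0 by rewrite e oner_neq0.
have [sm _ _] := elem_coef_neq0 nz.
rewrite E; split=> /=.
  rewrite (big_pred1 (support lam)) // => S /=.
  apply/andP/eqP => [[SL /eqP cS]|->]; last by rewrite subxx.
  by apply/eqP; rewrite eqEcard SL cS /=.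
by rewrite w sm (phi_lower lam (support lam)) sum_lower_split [X in (_ + (_ + X))%N]big1 ?addn0 // => i; rewrite !inE; lia.
Qed.

End Triangularity.

Section ElementaryCoefficient.

Variables (s N : nat) (m : 'X_{1..N}).
Implicit Types (lam : {ffun 'I_s -> nat}) (H : {ffun 'I_s -> {set 'I_N}}).

Definition col_set H (j : 'I_N) : {set 'I_s} := [set i | j \in H i].

Definition late H i (k : nat) : nat := #|[set j in H i | (k <= j)%N]|.

Definition matches H0 lam k H :=
  [forall i, (late H i k == lam i) &&
     [forall j : 'I_N, (j < k)%N ==> ((j \in H i) == (j \in H0 i))]].

Lemma late_peel H i (j : 'I_N) : late H i j = ((j \in H i) + late H i j.+1)%N.
Proof.
rewrite /late (cardsD1 j) inE leqnn andbT; congr (_ + _)%N.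
apply: eq_card => k; rewrite !inE ltn_neqAle [k == j]eq_sym.
by rewrite andbCA.
Qed.

Definition set_col H0 (j : 'I_N) (S : {set 'I_s}) : {ffun 'I_s -> {set 'I_N}} :=
  [ffun i => if i \in S then j |: H0 i else H0 i :\ j].

Lemma matches_peel H0 lam (j : 'I_N) (S : {set 'I_s}) H :
  matches H0 lam j H && (col_set H j == S) =
  (S \subset support lam) && matches (set_col H0 j S) (lower lam S) j.+1 H.
Proof.
have E0 i k : (k \in set_col H0 j S i) = if k == j then i \in S else k \in H0 i.
  by rewrite ffunE; case: (i \in S); rewrite !inE; case: eqP.
apply/andP/andP => [[/forallP h /eqP eS]|[/subsetP SL /forallP h]].
  have eSi i : (i \in S) = (j \in H i) by rewrite -eS inE.
  have hl i : lam i = ((i \in S) + late H i j.+1)%N.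
    by case/andP: (h i) => /eqP <- _; rewrite late_peel eSi.
  split; first by apply/subsetP => i iS; rewrite inE hl iS.
  apply/forallP => i; rewrite ffunE hl addKn eqxx /=.
  apply/forallP => k; apply/implyP; rewrite E0 ltnS leq_eqVlt.
  have [-> _|kj] /= := eqVneq k j; first by rewrite eSi.
  rewrite -val_eqE in kj; rewrite (negbTE kj) /= => lkj.
  by case/andP: (h i) => _ /forallP/(_ k)/implyP/(_ lkj).
have eSi i : (j \in H i) = (i \in S).
  case/andP: (h i) => _ /forallP/(_ j)/implyP/(_ (ltnSn j))/eqP ->.
  by rewrite E0 eqxx.
split; last by apply/eqP/setP => i; rewrite inE eSi.
apply/forallP => i; case/andP: (h i) => /eqP hl /forallP hk.
rewrite late_peel hl eSi ffunE; apply/andP; split.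
  by case iS: (i \in S); rewrite ?subn0 ?add0n // subnKC //; have := SL i iS; rewrite inE.
apply/forallP => k; apply/implyP => kj.
have /implyP/(_ (ltnW kj)) := hk k; rewrite E0 ifN //.
by rewrite -val_eqE /= ltn_eqF.
Qed.

Lemma sum_matches k H0 lam : (k <= N)%N ->
  \sum_(H | matches H0 lam k H)
    \prod_(j < N | (k <= j)%N) (#|col_set H j| == nth 0%N m j)%:R
  = elem_coef lam (drop k m).
Proof.
move=> kN; move: (subnK kN); move: (N - k)%N => d.
elim: d k kN H0 lam => [|d IH] k kN H0 lam ek.
  have {ek} -> : k = N by rewrite -ek.
  rewrite drop_oversize ?size_tuple //=.
  have l0 H i : late H i N = 0%N.
    by apply/eqP; rewrite cards_eq0 -subset0; apply/subsetP => j; rewrite !inE leqNgt ltn_ord andbF.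
  have [L0|/set0Pn[i]] := eqVneq (support lam) set0; last first.
    rewrite inE => li; rewrite big_pred0 // => H; apply/negbTE/negP => /forallP/(_ i).
    by rewrite l0 eq_sym eqn0Ngt li.
  rewrite (big_pred1 H0) => [|H].
    by rewrite big_pred0 // => i; rewrite leqNgt ltn_ord.
  apply/forallP/eqP => [h|-> i]; last first.
    rewrite l0; move/setP: L0 => /(_ i); rewrite !inE lt0n => /negbFE/eqP ->.
    by rewrite eqxx /=; apply/forallP => j; rewrite eqxx implybT.
  apply/ffunP => i; apply/setP => j; case/andP: (h i) => _ /forallP/(_ j).
  by rewrite ltn_ord => /eqP.
have {}kN : (k < N)%N by rewrite -ek addSn ltnS leq_addl.
pose j := Ordinal kN.
rewrite (drop_nth 0%N) ?size_tuple //=.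
rewrite (partition_big (fun H => col_set H j) xpredT) //=.
rewrite [RHS]big_mkcond; apply: eq_bigr => S _ /=.
under eq_bigl => H do rewrite (matches_peel H0 lam j S H).
case SL: (S \subset support lam) => /=; last by rewrite big_pred0.
rewrite -(IH k.+1 kN (set_col H0 j S)) ?addnS //.
transitivity (\sum_(H | matches (set_col H0 j S) (lower lam S) k.+1 H)
    (#|S| == nth 0%N m k)%:R *
    \prod_(i < N | (k.+1 <= i)%N) (#|col_set H i| == nth 0%N m i)%:R : {poly int}).
  apply: eq_bigr => H hH; rewrite (bigD1 j) //=; congr (_ * _).
    have := matches_peel H0 lam j S H; rewrite hH SL /= => /andP[_ /eqP ->] //.
  by apply: eq_bigl => i; rewrite -val_eqE /= [RHS]ltn_neqAle eq_sym andbC.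
rewrite -mulr_sumr; case: ifP => _; first by rewrite mul1r.
by rewrite mul0r.
Qed.

End ElementaryCoefficient.

Definition part_fun (la : seq nat) : {ffun 'I_(size la) -> nat} :=
  [ffun i : 'I_(size la) => nth 0%N la i].

Lemma mcoeff_elem_sym N (la : intpart) (m : 'X_{1..N}) :
  (elem_sym N la)@_m = elem_coef (part_fun la) m.
Proof.
rewrite -[m : seq nat]drop0 -(@sum_matches _ N m 0 [ffun=> set0]) //.
rewrite /elem_sym (big_nth 0%N) big_mkord /mesym bigA_distr_big_dep raddf_sum /=.
apply: eq_big => [H|H _].
  apply/familyP/forallP => h i; last first.
    case/andP: (h i) => /eqP; rewrite ffunE => <- _; rewrite unfold_in /=.
    by apply/eqP; apply: eq_card => j; rewrite !inE andbT.
  have := h i; rewrite unfold_in ffunE => /eqP <-; apply/andP; split.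
    by apply/eqP; apply: eq_card => j; rewrite !inE andbT.
  by apply/forallP.
rewrite prod_natr_bool; under eq_bigr => i _ do rewrite mprodXE.
rewrite mprodXE mcoeffX; congr (_%:R); congr (nat_of_bool _).
have E j : (\sum_(i < size la) \sum_(k in H i) U_(k))%MM j = #|col_set H j|.
  rewrite mnm_sumE -sum1_card [RHS]big_mkcond; apply: eq_bigr => i _.
  rewrite mnm_sumE inE; case: ifP => jH.
    rewrite (bigD1 j) //= mnm1E eqxx big1 // => k /andP[_ /negbTE kj].
    by rewrite mnm1E kj.
  by rewrite big1 // => k kH; rewrite mnm1E; case: eqP => // kj; rewrite -kj kH in jH.
apply/eqP/forallP => [<- j|h]; first by rewrite -mnm_nth E.
by apply/mnmP => j; rewrite E (eqP (h j)) -mnm_nth.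
Qed.

Lemma subset_lower s (lam : {ffun 'I_s -> nat}) (S T : {set 'I_s}) :
  (S \subset support lam) && (T \subset support (lower lam S)) =
  [forall i, (i \in S) + (i \in T) <= lam i]%N.
Proof.
apply/andP/forallP => [[/subsetP SL /subsetP TL] i|h].
  have := SL i; have := TL i; rewrite !inE ffunE.
  case: (i \in S); case: (i \in T) => //= h1 h2.
  - by have := h1 isT; lia.
  - exact: h2.
  - by have := h1 isT; lia.
split; apply/subsetP => i iS; rewrite !inE ?ffunE; have := h i; rewrite iS; lia.
Qed.

Lemma lowerC s (lam : {ffun 'I_s -> nat}) (S T : {set 'I_s}) :
  lower (lower lam S) T = lower (lower lam T) S.
Proof. by apply/ffunP => i; rewrite !ffunE subnAC. Qed.

Lemma elem_coef_swap s (lam : {ffun 'I_s -> nat}) a b al :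
  elem_coef lam [:: a, b & al] = elem_coef lam [:: b, a & al].
Proof.
have dep (S T : {set 'I_s}) : (S \subset support lam) ->
    (T \subset support (lower lam S)) ->
    (T \subset support lam) && (S \subset support (lower lam T)).
  move=> h1 h2; rewrite subset_lower; have := subset_lower lam S T.
  by rewrite h1 h2 => /esym; under eq_forallb => i do rewrite addnC.
rewrite /= (exchange_big_dep (fun T : {set 'I_s} => (T \subset support lam) && (#|T| == b))) /=.
  apply: eq_bigr => T /andP[TL /eqP cT]; apply: eq_big => [S|S _]; last by rewrite lowerC.
  rewrite cT eqxx andbT andbAC; congr (_ && _); apply/andP/idP => [[h1 h2]|h].
    by case/andP: (dep _ _ h1 h2).
  by apply/andP; apply: dep.
by move=> S T /andP[h1 _] /andP[h2 ->]; case/andP: (dep _ _ h1 h2) => ->.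
Qed.

Lemma elem_coef_zero s (lam : {ffun 'I_s -> nat}) al :
  elem_coef lam (0%N :: al) = elem_coef lam al.
Proof.
rewrite /= (big_pred1 set0) => [|S]; last first.
  by rewrite /= cards_eq0; case: eqP => [->|]; rewrite ?sub0set // andbF.
by congr (elem_coef _ _); apply/ffunP => i; rewrite ffunE inE subn0.
Qed.

Lemma chrom_coef_swap_at n (prec : rel 'I_n)
    (prec_lt : forall i j, prec i j -> (i < j)%N)
    (prec_mono : forall i i' j j' : 'I_n,
       (i' <= i)%N -> prec i j -> (j <= j')%N -> prec i' j') R pre a b al :
  chrom_coef prec R (pre ++ [:: a, b & al]) =
  chrom_coef prec R (pre ++ [:: b, a & al]).
Proof.
elim: pre R => [|c pre IH] R; first exact: chrom_coef_swap.
by rewrite /=; apply: eq_bigr => C _; rewrite IH.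
Qed.

Lemma elem_coef_swap_at s (lam : {ffun 'I_s -> nat}) pre a b al :
  elem_coef lam (pre ++ [:: a, b & al]) = elem_coef lam (pre ++ [:: b, a & al]).
Proof.
elim: pre lam => [|c pre IH] lam; first exact: elem_coef_swap.
by rewrite /=; apply: eq_bigr => S _; rewrite IH.
Qed.

Section Symmetry.

Variables (A : Type) (w : seq nat -> A).
Hypothesis w_swap : forall pre a b al,
  w (pre ++ [:: a, b & al]) = w (pre ++ [:: b, a & al]).
Hypothesis w_zero : forall al, w (0%N :: al) = w al.

Lemma sym_perm al be : perm_eq al be -> w al = w be.
Proof.
have move_in pre a b1 b2 : w (pre ++ a :: b1 ++ b2) = w (pre ++ b1 ++ a :: b2).
  elim: b1 pre => [|c b1 IH] pre //=.
  by rewrite w_swap -cat_rcons IH cat_rcons.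
suff: forall pre, perm_eq al be -> w (pre ++ al) = w (pre ++ be) by move/(_ [::]).
elim: al be => [|a al IH] be pre; first by move/perm_size/esym/size0nil => ->.
move=> h; have ab : a \in be by rewrite -(perm_mem h) mem_head.
case/splitPr: be / ab h => b1 b2 h.
rewrite -move_in -!cat_rcons; apply: IH.
by move: h; rewrite perm_sym -[a :: b2]cat1s perm_catCA /= perm_cons perm_sym.
Qed.

Lemma sym_mkpart al : w al = w (mkpart al).
Proof.
transitivity (w [seq i <- al | (0 < i)%N]); last first.
  by apply: sym_perm; rewrite perm_sym perm_sort.
suff: forall pre, w (pre ++ al) = w (pre ++ [seq i <- al | (0 < i)%N]) by move/(_ [::]).
elim: al => [|[|a] al IH] pre //=; last by rewrite -!cat_rcons IH.
transitivity (w (0%N :: pre ++ al)); last by rewrite w_zero IH.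
by apply: sym_perm; rewrite -[0%N :: al]cat1s perm_catCA.
Qed.

End Symmetry.


Lemma mem_part (la : intpart) i : i \in (la : seq nat) -> (0 < i)%N.
Proof.
case: la => s /= /andP[_ s0] si; rewrite lt0n; apply: contraNneq s0 => <-; exact: si.
Qed.

Lemma sorted_part (la : intpart) : sorted geq la.
Proof. by case: la => s /= /andP[]. Qed.

Lemma geq_trans : transitive geq.
Proof. by move=> y x z /= xy yz; apply: leq_trans yz xy. Qed.

Lemma geq_anti : antisymmetric geq.
Proof. by move=> x y /=; rewrite andbC => /anti_leq. Qed.

Lemma mkpart_sorted (al : seq nat) :
  sorted geq al -> mkpart al = [seq i <- al | (0 < i)%N] :> seq nat.
Proof.
move=> al_sorted; rewrite /= sorted_sort //; first exact: geq_trans.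
by apply: sorted_filter al_sorted; apply: geq_trans.
Qed.

Lemma part_eq (la mu : intpart) : perm_eq la mu -> la = mu.
Proof.
move=> h; apply: val_inj => /=.
exact: (sorted_eq geq_trans geq_anti (sorted_part la) (sorted_part mu) h).
Qed.

Lemma mkpart_id (la : intpart) : mkpart la = la.
Proof.
apply: val_inj; rewrite /= -[RHS](@sorted_sort _ geq) ?sorted_part //; last exact: geq_trans.
congr (sort _ _); apply/all_filterP/allP => i; exact: mem_part.
Qed.

Definition parts_gt (s : seq nat) j := count (fun i => j < i)%N s.

Lemma part_eq_count (la mu : intpart) :
  (forall j, parts_gt la j = parts_gt mu j) -> la = mu.
Proof.
have E (nu : intpart) j : parts_gt nu j = (count_mem j.+1 nu + parts_gt nu j.+1)%N.
  rewrite /parts_gt -count_predUI [X in (_ + X)%N](_ : _ = 0%N) ?addn0.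
    by apply: eq_count => i /=; rewrite leq_eqVlt eq_sym.
  apply/eqP; rewrite -leqn0 leqNgt -has_count; apply/hasPn => i _ /=.
  by case: eqP => // ->; rewrite ltnn.
move=> h; apply: part_eq; apply/allP => i _ /=; case: i => [|i].
  have Z (nu : intpart) : count_mem 0%N nu = 0%N.
    apply/eqP; rewrite -leqn0 leqNgt -has_count; apply/hasPn => i /mem_part /=.
    by case: i.
  by rewrite !Z.
by rewrite -(eqn_add2r (parts_gt la i.+1)) -E (h i.+1) -E h.
Qed.

Lemma column_part (s : seq nat) j : column (part_fun s) j = parts_gt s j.
Proof.
rewrite /column /parts_gt -sum1_card big_set -sum1_count (big_nth 0%N) big_mkord.
by apply: eq_bigl => i; rewrite unfold_in ffunE.
Qed.

Lemma sum_part (s : seq nat) : (\sum_i part_fun s i = sumn s)%N.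
Proof.
by rewrite sumnE (big_nth 0%N) big_mkord; apply: eq_bigr => i _; rewrite ffunE.
Qed.

Lemma parts_gt_sorted (s : seq nat) i j : sorted geq s ->
  (j < parts_gt s i)%N = (i < nth 0%N s j)%N.
Proof.
elim: s j => [|a s IH] j /=; first by rewrite nth_nil.
move=> sa; have ss : sorted geq s := path_sorted sa.
have sle x : x \in s -> (x <= a)%N.
  by move: sa; rewrite (path_sortedE geq_trans) => /andP[/allP h _] /h.
rewrite /parts_gt /=; case: j => [|j] /=.
  case: (ltnP i a) => [//|ai]; rewrite add0n -has_count; apply/negbTE/hasPn => x /sle xa.
  by rewrite -leqNgt; apply: leq_trans xa ai.
case: (ltnP i a) => ai /=; first by rewrite add1n ltnS -IH.
rewrite add0n -IH // /parts_gt (_ : count _ _ = 0%N) //.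
apply/eqP; rewrite -leqn0 leqNgt -has_count; apply/hasPn => x /sle xa.
by rewrite -leqNgt; exact: leq_trans xa ai.
Qed.

Definition conj_part (la : intpart) : intpart :=
  mkpart (mkseq (parts_gt la) (head 0%N la)).

Lemma parts_gt_eq0 (la : intpart) j : (head 0%N la <= j)%N -> parts_gt la j = 0%N.
Proof.
move=> h; apply/eqP; rewrite -leqn0 leqNgt parts_gt_sorted ?sorted_part //.
by rewrite nth0 -leqNgt.
Qed.

Lemma conj_partE (la : intpart) :
  conj_part la = mkseq (parts_gt la) (head 0%N la) :> seq nat.
Proof.
rewrite mkpart_sorted.
  apply/all_filterP/allP => i /mapP[j]; rewrite mem_iota /= => h ->.
  by rewrite parts_gt_sorted ?sorted_part // nth0.
rewrite sorted_map; apply: sub_sorted (iota_sorted 0 _) => i j /= ij.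
by apply: sub_count => x /= /(leq_ltn_trans ij).
Qed.

Lemma nth_conj (la : intpart) j : nth 0%N (conj_part la) j = parts_gt la j.
Proof.
rewrite conj_partE; have [jh|hj] := ltnP j (head 0%N la); first by rewrite nth_mkseq.
by rewrite nth_default ?size_mkseq // parts_gt_eq0.
Qed.

Lemma parts_gt_conj (la : intpart) j : parts_gt (conj_part la) j = nth 0%N la j.
Proof.
apply/eqP; rewrite eqn_leq; apply/andP; split.
  rewrite leqNgt; apply/negP; rewrite parts_gt_sorted ?sorted_part // nth_conj.
  by rewrite parts_gt_sorted ?sorted_part // ltnn.
case e: (nth 0%N la j) => [|k] //.
rewrite parts_gt_sorted ?sorted_part // nth_conj parts_gt_sorted ?sorted_part //.
by rewrite e.
Qed.

Lemma conj_partK : involutive conj_part.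
Proof. by move=> la; apply: part_eq_count => j; rewrite parts_gt_conj nth_conj. Qed.

Lemma elem_coef_conj (la : intpart) :
  elem_coef (part_fun (conj_part la)) la = 1 /\
  weight la = phi (part_fun (conj_part la)).
Proof.
have E : mkseq (column (part_fun (conj_part la))) (size la) = la.
  apply: (@eq_from_nth _ 0%N) => [|i]; rewrite size_mkseq // => ila.
  by rewrite nth_mkseq // column_part parts_gt_conj.
have [i|e w] := @elem_coef_column _ (part_fun (conj_part la)) (size la).
  by rewrite ffunE nth_conj count_size.
by rewrite E in e w.
Qed.

Lemma elem_coef_part (mu la : intpart) : elem_coef (part_fun mu) la != 0 ->
  [/\ sumn la = sumn mu, (phi (part_fun mu) <= weight la)%N &
      phi (part_fun mu) = weight la -> mu = conj_part la].
Proof.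
case/elem_coef_neq0; rewrite sum_part => -> h1 h2; split=> // /h2 h.
by apply: part_eq_count => j; rewrite -column_part -h parts_gt_conj.
Qed.

(** * Existence of the expansion *)

Definition partitions (n : nat) : seq intpart :=
  [seq la : intpart <-
     undup [seq mkpart [seq val i | i <- t] | t : n.-tuple 'I_n.+1] | sumn la == n].

Lemma size_part_le (la : intpart) : (size la <= sumn la)%N.
Proof.
have := @mem_part la; elim: (la : seq nat) => [|a s IH] //= h.
have := h a; rewrite mem_head => /(_ isT) a0.
have {}IH : (size s <= sumn s)%N by apply: IH => i si; apply: h; rewrite inE si orbT.
by rewrite -add1n leq_add.
Qed.

Lemma mem_leq_sumn (s : seq nat) i : i \in s -> (i <= sumn s)%N.
Proof.
elim: s => [|a s IH] //=; rewrite inE => /orP[/eqP ->|/IH]; first exact: leq_addr.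
by move=> h; apply: leq_trans h (leq_addl _ _).
Qed.

Lemma mem_partitions n (la : intpart) : (la \in partitions n) = (sumn la == n).
Proof.
rewrite mem_filter; case: eqP => //= ln; rewrite mem_undup.
pose s : seq nat := la ++ nseq (n - size la) 0%N.
have sz : size s == n by rewrite size_cat size_nseq subnKC // -ln size_part_le.
have szt : size [seq inord i : 'I_n.+1 | i <- s] == n by rewrite size_map.
apply/mapP; exists (Tuple szt); first by rewrite mem_enum.
have E : [seq val i | i <- Tuple szt] = s.
  rewrite /= -map_comp -[RHS]map_id; apply/eq_in_map => i /= is_.
  rewrite inordK // ltnS; move: is_; rewrite mem_cat => /orP[/mem_leq_sumn|].
    by rewrite ln.
  by rewrite mem_nseq => /andP[_ /eqP ->].
rewrite E -[LHS]mkpart_id; apply: val_inj => /=; congr (sort _ _).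
by rewrite filter_cat [X in _ ++ X](_ : _ = [::]) ?cats0 //; elim: (n - _)%N.
Qed.

Lemma partitions_uniq n : uniq (partitions n).
Proof. by rewrite filter_uniq // undup_uniq. Qed.

(* The matrix of the [elem_coef (part_fun mu) la] is unitriangular with respect
   to [conj_part] and to the order by [weight]. *)
Lemma elem_expansion n (w : seq nat -> {poly int}) :
  exists f : intpart -> {poly int}, forall la, la \in partitions n ->
    w la = \sum_(mu <- partitions n) f mu * elem_coef (part_fun mu) la.
Proof.
suff [f fP] : exists f : intpart -> {poly int}, forall la, la \in partitions n ->
    (weight la < (\max_(mu <- partitions n) weight mu).+1)%N ->
    w la = \sum_(mu <- partitions n) f mu * elem_coef (part_fun mu) la.
  by exists f => la lan; apply: fP => //; rewrite ltnS (bigD1_seq la) ?partitions_uniq //= leq_maxl.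
elim: (_.+1) => [|k [f fP]]; first by exists (fun=> 0).
pose g (mu : intpart) := (phi (part_fun mu) == k)%:R *
  (w (conj_part mu) -
   \sum_(nu <- partitions n) f nu * elem_coef (part_fun nu) (conj_part mu)).
exists (fun mu : intpart => f mu + g mu) => la lan; rewrite ltnS leq_eqVlt.
under eq_bigr => mu _ do rewrite mulrDl.
rewrite big_split /= => /orP[/eqP wk|wk]; last first.
  rewrite -fP // big1 ?addr0 // => mu _.
  have [->|/elem_coef_part[_ le_w _]] :=
    eqVneq (elem_coef (part_fun mu) la) 0; first by rewrite mulr0.
  by rewrite /g ltn_eqF ?mul0r // (leq_ltn_trans le_w).
have [e1 e2] := elem_coef_conj la.
have [e3 _ _] : [/\ sumn la = sumn (conj_part la),
    (phi (part_fun (conj_part la)) <= weight la)%N &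
    phi (part_fun (conj_part la)) = weight la -> conj_part la = conj_part la].
  by apply: elem_coef_part; rewrite e1 oner_neq0.
have cn : conj_part la \in partitions n by rewrite mem_partitions -e3 -mem_partitions.
rewrite [X in _ + X](bigD1_seq (conj_part la)) ?partitions_uniq //=.
rewrite e1 mulr1 /g -e2 wk eqxx mul1r conj_partK.
rewrite [X in _ = _ + (_ + X)]big1 ?addr0; first by rewrite addrC subrK.
move=> mu muP; have [->|/elem_coef_part[_ _ h]] :=
  eqVneq (elem_coef (part_fun mu) la) 0; first by rewrite mulr0.
rewrite -wk; case: eqP => [/h mue|_]; last by rewrite !mul0r.
by rewrite mue eqxx in muP.
Qed.

Lemma elem_coef_mkpart s (lam : {ffun 'I_s -> nat}) al :
  elem_coef lam al = elem_coef lam (mkpart al).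
Proof.
by apply: (sym_mkpart (w := elem_coef lam)) => *; [apply: elem_coef_swap_at|apply: elem_coef_zero].
Qed.

Lemma elem_coef_degree (mu : intpart) al :
  sumn al != sumn mu -> elem_coef (part_fun mu) al = 0.
Proof.
by move=> ne; apply/eqP; apply: contraNT ne => /elem_coef_neq0[->]; rewrite sum_part.
Qed.

Lemma sumn_mkpart al : sumn (mkpart al) = sumn al.
Proof.
rewrite /= (perm_sumn (s2 := [seq i <- al | (0 < i)%N])) ?perm_sort //.
by elim: al => [|[|a] al IH] //=; rewrite IH.
Qed.

Section Expansion.

Variables (n : nat) (prec : rel 'I_n).
Hypothesis prec_lt : forall i j, prec i j -> (i < j)%N.
Hypothesis prec_mono : forall i i' j j' : 'I_n,
  (i' <= i)%N -> prec i j -> (j <= j')%N -> prec i' j'.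

Lemma e_expansionP (f : {fsfun intpart -> {poly int} with 0}) :
  e_expansion (inc_graph prec) f <->
  forall al, chrom_coef prec setT al =
    \sum_(la <- finsupp f) f la * elem_coef (part_fun la) al.
Proof.
have E N (m : 'X_{1..N}) :
    (\sum_(la <- finsupp f) f la *: elem_sym N la)@_m =
    \sum_(la <- finsupp f) f la * elem_coef (part_fun la) m.
  by rewrite raddf_sum; apply: eq_bigr => la _; rewrite /= mcoeffZ mcoeff_elem_sym.
split=> h.
  move=> al; pose m := Multinom (in_tuple al).
  by have := congr1 (mcoeff m) (h (size al)); rewrite E mcoeff_chrom_qsym.
by move=> N; apply/mpolyP => m; rewrite E mcoeff_chrom_qsym.
Qed.

Lemma chrom_coef_mkpart al : chrom_coef prec setT al = chrom_coef prec setT (mkpart al).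
Proof.
apply: (sym_mkpart (w := chrom_coef prec setT)) => *; last exact: chrom_coef_zero.
exact: chrom_coef_swap_at.
Qed.

Lemma e_expansion_exists :
  exists f : {fsfun intpart -> {poly int} with 0}, e_expansion (inc_graph prec) f.
Proof.
have [f fP] := elem_expansion n (chrom_coef prec setT).
pose g : {fsfun intpart -> {poly int} with 0} :=
  [fsfun la in seq_fset tt (partitions n) => f la].
exists g; apply/e_expansionP => al.
have -> : \sum_(la <- finsupp g) g la * elem_coef (part_fun la) al =
    \sum_(la <- partitions n) f la * elem_coef (part_fun la) al.
  have gE la : la \in partitions n -> g la = f la.
    by move=> lan; rewrite fsfunE seq_fsetE lan.
  rewrite (perm_big [seq la <- partitions n | f la != 0]) /=.
    rewrite big_filter big_mkcond big_seq [RHS]big_seq; apply: eq_bigr => la lan.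
    by rewrite gE //; case: eqP => // ->; rewrite mul0r.
  apply: uniq_perm => [||la]; [exact: fset_uniq|exact/filter_uniq/partitions_uniq|].
  rewrite mem_finsupp mem_filter fsfunE seq_fsetE.
  by case: ifP; rewrite ?andbT ?andbF ?eqxx.
have [aln|aln] := eqVneq (sumn al) n.
  rewrite chrom_coef_mkpart fP; last by rewrite mem_partitions sumn_mkpart aln.
  by apply: eq_bigr => mu _; rewrite -elem_coef_mkpart.
rewrite chrom_coef_degree ?cardsT ?card_ord // big_seq big1 // => mu.
by rewrite mem_partitions => /eqP mun; rewrite elem_coef_degree ?mulr0 // mun.
Qed.

End Expansion.

(** * Extraction of the coefficient *)

Lemma eq_head_sum h K j w w' : (forall al, w al = w' al) ->
  head_sum h K j w = head_sum h K j w'.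
Proof.
move=> e; rewrite (@head_sum_linear _ [:: tt] xpredT (fun=> 1) h K j (fun=> w') w).
  by rewrite big_seq1 mul1r.
by move=> al; rewrite big_seq1 mul1r e.
Qed.

Lemma head_sum_0 h K j w : (forall al, w al = 0) -> head_sum h K j w = 0.
Proof.
move=> e; rewrite (@head_sum_linear _ (Nil unit) xpredT (fun=> 1) h K j (fun=> w) w).
  by rewrite big_nil.
by move=> al; rewrite big_nil e.
Qed.

Lemma elem_coef_triples (lam : {ffun 'I_3 -> nat}) l al :
  elem_coef lam (nseq l 3 ++ al) =
  if [forall i, l <= lam i]%N then elem_coef [ffun i => lam i - l]%N al else 0.
Proof.
elim: l lam => [|l IH] lam.
  have -> : [forall i, 0 <= lam i]%N by apply/forallP.
  by congr (elem_coef _ _); apply/ffunP => i; rewrite ffunE subn0.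
rewrite /=; have [L|] := eqVneq (support lam) setT.
  rewrite (big_pred1 setT) => [|S]; last first.
    rewrite /= L subsetT /=; apply/eqP/eqP => [cS|->]; last by rewrite cardsT card_ord.
    by apply/eqP; rewrite eqEcard subsetT cardsT card_ord cS.
  have lpos i : (0 < lam i)%N by move/setP: L => /(_ i); rewrite !inE.
  rewrite IH; have -> : [forall i, l <= lower lam setT i]%N = [forall i, l < lam i]%N.
    by apply: eq_forallb => i; rewrite ffunE inE; have := lpos i; case: (lam i) => // k; rewrite subn1.
  have -> : [ffun i => lower lam setT i - l]%N = [ffun i => lam i - l.+1]%N :> {ffun 'I_3 -> nat}.
    by apply/ffunP => i; rewrite !ffunE inE -subnDA.
  by [].
move=> L; rewrite big_pred0 => [|S].
  rewrite ifN //; apply: contraNN L => /forallP h; apply/eqP/setP => i.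
  by rewrite !inE; apply: leq_trans (h i).
apply: contraNF L => /andP[SL /eqP cS]; rewrite -subTset; apply: subset_trans SL.
by have -> : S = setT by apply/eqP; rewrite eqEcard subsetT cardsT card_ord cS.
Qed.

Lemma elem_coef_small s (lam : {ffun 'I_s -> nat}) a al :
  (s < a)%N -> elem_coef lam (a :: al) = 0.
Proof.
by move=> sa; apply/eqP; apply: contraTT sa => /elem_coef_head; rewrite -leqNgt.
Qed.

Lemma card_support s (lam : {ffun 'I_s -> nat}) :
  #|support lam| = (\sum_i (0 < lam i))%N.
Proof.
rewrite -sum1_card big_set [LHS]big_mkcond; apply: eq_bigr => i _.
by rewrite unfold_in; case: ltnP.
Qed.

Lemma card_support_part (la : intpart) : #|support (part_fun la)| = size la.
Proof.
rewrite card_support -[RHS]card_ord -sum1_card; apply: eq_bigr => i _.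
by rewrite ffunE (mem_part (mem_nth _ _)).
Qed.

Section ThreeParts.

Variables (n l : nat).
Hypothesis ln : (3 * l <= n)%N.

Let target := mkpart [:: n - 2 * l; l; l]%N.

Lemma target0 : l = 0%N -> (0 < n)%N -> target = [:: n] :> seq nat.
Proof. by move=> l0 n0; rewrite mkpart_sorted /= l0 ?subn0 ?n0. Qed.

Lemma targetS : (0 < l)%N -> target = [:: n - 2 * l; l; l]%N :> seq nat.
Proof.
move=> l0; rewrite mkpart_sorted /=; first by rewrite l0 ifT //; lia.
by rewrite leqnn andbT; lia.
Qed.

Lemma part_size3 (la : intpart) : (size la <= 3)%N -> sumn la = n -> (0 < l)%N ->
  (size la < 3)%N /\ la != target \/
  exists a b c, [/\ la = [:: a; b; c] :> seq nat, (b <= a)%N, (c <= b)%N,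
     (a + b + c)%N = n & (la == target) = (b == l) && (c == l)].
Proof.
move=> s3 sn l0; have [s3'|s3'] := ltnP (size la) 3.
  by left; split=> //; apply: contraTneq s3' => ->; rewrite targetS.
right; have {s3 s3'} s3 : size la = 3 by apply/eqP; rewrite eqn_leq s3.
have -> : (la == target) = ((la : seq nat) == [:: n - 2 * l; l; l]%N).
  by rewrite -val_eqE -(targetS l0).
have := sorted_part la; move: s3 sn; case: (la : seq nat) => [|a [|b [|c [|]]]] //= _ sn.
rewrite andbT => /andP[ab bc]; exists a, b, c; split=> //; first by lia.
by apply/eqP/andP => [[_ -> ->]//|[/eqP bl /eqP cl]]; rewrite bl cl; congr (_ :: _); lia.
Qed.

Lemma head_sum_triples K j (la : intpart) : (3 * l < n)%N ->
  (3 <= K)%N -> (n <= j.+1)%N -> (size la <= 3)%N -> sumn la = n ->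
  head_sum (fun a => a%:R) K j
     (fun al => elem_coef (part_fun la) (nseq l 3 ++ al)) = (la == target)%:R.
Proof.
move=> l3n K3 nj s3 sn; have [l0|l0] := posnP l.
  rewrite (@eq_head_sum _ _ _ _ (elem_coef (part_fun la))); last by move=> al; rewrite l0.
  rewrite head_sum_card_elem ?sum_part ?sn // ?(leq_trans s3) //.
  have -> : (la == target) = ((la : seq nat) == [:: n]).
    by rewrite -val_eqE -target0 //; lia.
  rewrite card_support_part; move: sn; case: (la : seq nat) => [|a [|b s]] //= sn; rewrite ?eqseq_cons ?andbF //.
  by rewrite -sn addn0 !eqxx.
have [[s3' /negbTE ->]|[a [b [c [E ab bc abc ->]]]]] := part_size3 s3 sn l0.
  apply: head_sum_0 => al; rewrite -(prednK l0) /=.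
  exact: elem_coef_small.
rewrite E (@eq_head_sum _ _ _ _ _ (fun al => elem_coef_triples (part_fun [:: a; b; c]) l al)).
have lE : [forall i : 'I_3, l <= part_fun [:: a; b; c] i]%N = (l <= c)%N.
  apply/forallP/idP => [/(_ ord_max)|lc i]; first by rewrite ffunE.
  by rewrite ffunE; case: i => -[|[|[|]]] //= _; lia.
rewrite lE; have [lc|cl] := leqP l c; last first.
  rewrite head_sum_0 // (_ : (c == l) = false) ?andbF //; lia.
rewrite head_sum_card_elem //; last first.
  rewrite !big_ord_recl big_ord0 !ffunE /=; lia.
rewrite card_support !big_ord_recl big_ord0 !ffunE /=; congr (_%:R); congr (nat_of_bool _).
by lia.
Qed.

Lemma elem_coef_triples_part (la : intpart) : n = (3 * l)%N -> (0 < n)%N ->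
  (size la <= 3)%N -> sumn la = n ->
  elem_coef (part_fun la) (nseq l 3) = (la == target)%:R.
Proof.
move=> nl n0 s3 sn; have l0 : (0 < l)%N by lia.
have [[s3' /negbTE ->]|[a [b [c [E ab bc abc ->]]]]] := part_size3 s3 sn l0.
  by rewrite -(prednK l0) /=; apply: elem_coef_small.
rewrite E -[nseq l 3]cats0 elem_coef_triples.
have lE : [forall i : 'I_3, l <= part_fun [:: a; b; c] i]%N = (l <= c)%N.
  apply/forallP/idP => [/(_ ord_max)|lc i]; first by rewrite ffunE.
  by rewrite ffunE; case: i => -[|[|[|]]] //= _; lia.
rewrite lE; have [lc|cl] := leqP l c; last first.
  rewrite (_ : (c == l) = false) ?andbF //; lia.
rewrite /= sum_eq0 !big_ord_recl big_ord0 !ffunE /=; congr (_%:R); congr (nat_of_bool _).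
by lia.
Qed.

End ThreeParts.

Section Positivity.

Variables (n : nat) (prec : rel 'I_n).
Hypothesis prec_lt : forall i j, prec i j -> (i < j)%N.
Hypothesis prec_mono : forall i i' j j' : 'I_n,
  (i' <= i)%N -> prec i j -> (j <= j')%N -> prec i' j'.
Variable h : nat.
Hypothesis height : forall C, chain prec C -> (#|C| <= h)%N.
Variable f : {fsfun intpart -> {poly int} with 0}.
Hypothesis f_exp : e_expansion (inc_graph prec) f.

Let chrom_coefE := (e_expansionP prec_lt f).1 f_exp.

Lemma chrom_coef_tall a al : (h < a)%N -> chrom_coef prec setT (a :: al) = 0.
Proof.
move=> ha; apply: big_pred0 => C; apply/negbTE/negP => /and3P[_ /height hC /eqP cC].
by rewrite -cC ltnNge hC in ha.
Qed.

(* Among the offending [la], one with minimal [phi] is seen alone by the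
   monomial [conj_part la]. *)
Lemma e_coef_support (la : intpart) : f la != 0 -> (size la <= h)%N /\ sumn la = n.
Proof.
pose bad (mu : intpart) := (h < size mu)%N || (sumn mu != n).
suff fbad : bad la -> f la = 0.
  move=> f0; have: ~~ bad la by apply: contraNN f0 => /fbad ->.
  by rewrite negb_or -leqNgt negbK => /andP[-> /eqP ->].
have [k] := ubnP (phi (part_fun la)); elim: k la => // k IH la; rewrite ltnS => phik badla.
have [] := elem_coef_conj (conj_part la); rewrite conj_partK => e1 wt.
have : chrom_coef prec setT (conj_part la) = 0.
  have [sn|sn] := eqVneq (sumn la) n; last first.
    apply: chrom_coef_degree; rewrite cardsT card_ord; apply: contraNneq sn => <-.
    by have /elem_coef_part[-> _ _] : elem_coef (part_fun la) (conj_part la) != 0 by rewrite e1 oner_neq0.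
  have : (h < size la)%N by move: badla; rewrite /bad sn eqxx orbF.
  have <- : parts_gt la 0 = size la.
    by apply/eqP; rewrite -all_count; apply/allP => i; apply: mem_part.
  rewrite -nth_conj; case: (conj_part la : seq nat) => [//|a al]; exact: chrom_coef_tall.
rewrite chrom_coefE; have [laf|laf _] := boolP (la \in finsupp f); last first.
  exact: fsfun_dflt.
rewrite (bigD1_seq la) ?fset_uniq //= e1 mulr1 big1 ?addr0 // => mu mula.
have [->|nz] := eqVneq (elem_coef (part_fun mu) (conj_part la)) 0; first by rewrite mulr0.
have /elem_coef_part[s1 phile muE] := nz.
have [s2 _ _] : [/\ sumn (conj_part la) = sumn la, True & True].
  by have /elem_coef_part[-> _ _] : elem_coef (part_fun la) (conj_part la) != 0 by rewrite e1 oner_neq0.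
move: phile; rewrite leq_eqVlt => /orP[/eqP/muE mue|philt].
  by rewrite mue conj_partK eqxx in mula.
rewrite IH ?mul0r //; first by apply: leq_trans phik; rewrite -wt.
move: badla; rewrite /bad -s1 s2 => /orP[hla|->]; last by rewrite orbT.
apply/orP; left; apply: leq_trans hla _.
have <- : parts_gt la 0 = size la.
  by apply/eqP; rewrite -all_count; apply/allP => i; apply: mem_part.
rewrite -nth_conj; case: (conj_part la : seq nat) nz => [//|a al]; exact: elem_coef_head.
Qed.

End Positivity.

Section Height3.

Variables (n : nat) (prec : rel 'I_n).
Hypothesis prec_lt : forall i j, prec i j -> (i < j)%N.
Hypothesis prec_mono : forall i i' j j' : 'I_n,
  (i' <= i)%N -> prec i j -> (j <= j')%N -> prec i' j'.
Hypothesis height : forall C, chain prec C -> (#|C| <= 3)%N.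

Lemma npoly_e_coef (f : {fsfun intpart -> {poly int} with 0}) l :
  e_expansion (inc_graph prec) f -> (3 * l <= n)%N -> (0 < n)%N ->
  npoly (f (mkpart [:: n - 2 * l; l; l]%N)).
Proof.
move=> fE l3n n0; set target := mkpart _.
have single (G : intpart -> {poly int}) :
    (forall la, la \in finsupp f -> G la = (la == target)%:R) ->
    \sum_(la <- finsupp f) f la * G la = f target.
  move=> GE; have [tf|tf] := boolP (target \in finsupp f).
    rewrite (bigD1_seq target) ?fset_uniq //= GE // eqxx mulr1 big_seq_cond.
    by rewrite big1 ?addr0 // => la /andP[laf /negbTE lat]; rewrite GE // lat mulr0.
  rewrite fsfun_dflt // big_seq big1 // => la laf.
  by rewrite GE //; case: eqP laf tf => [-> ->|]; rewrite ?mulr0.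
have supp3 la : la \in finsupp f -> (size la <= 3)%N /\ sumn la = n.
  by rewrite mem_finsupp; apply: (e_coef_support prec_lt height fE).
have chromE := (e_expansionP prec_lt f).1 fE.
move: l3n; rewrite leq_eqVlt => /orP[/eqP nl|l3n].
  rewrite -(single (fun la => elem_coef (part_fun la) (nseq l 3))).
    by rewrite -chromE; apply: npoly_chrom_coef.
  by move=> la /supp3[s3 sn]; apply: elem_coef_triples_part => //; rewrite nl.
rewrite -(single (fun la => head_sum (fun a => a%:R) (maxn 3 n) n
     (fun al => elem_coef (part_fun la) (nseq l 3 ++ al)))).
  rewrite -(@head_sum_linear _ _ xpredT f _ _ _ 
      (fun la al => elem_coef (part_fun la) (nseq l 3 ++ al)) _ (fun al => chromE _)).
  by apply: npoly_head_sum_chrom => //; rewrite leq_maxr.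
by move=> la /supp3[s3 sn]; apply: head_sum_triples => //; rewrite ?leq_maxl // ltnW.
Qed.

End Height3.

Section Dyck.

Variables (n : nat) (d : seq nat).
Hypothesis hd : dyck_path n d.

Lemma dyck_mono (i j : nat) : (i <= j)%N -> (j.+1 < n)%N -> (nth n d i <= nth n d j)%N.
Proof.
case: hd => sd d_sorted _ ij jn.
by apply: (sorted_leq_nth leq_trans leqnn) => //; rewrite ?inE sd; lia.
Qed.

Lemma dyck_bound i : (i < n)%N -> (i < nth n d i <= n)%N.
Proof.
case: hd => sd _ h i_n; have [i1n|ni1] := ltnP i.+1 n; first exact: (h i.+1).
by rewrite nth_default ?sd ?i_n ?leqnn //; lia.
Qed.

Lemma dyck_ltE (i j : 'I_n) : dyck_lt d i j = (i.+1 < n)%N && (nth n d i <= j)%N.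
Proof. by rewrite /dyck_lt /dyck_at /= ltnS ltn_ord andbT. Qed.

Lemma dyck_lt_lt (i j : 'I_n) : dyck_lt d i j -> (i < j)%N.
Proof.
case: hd => _ _ /(_ i.+1) hi; rewrite dyck_ltE => /andP[i_n dj].
have /andP[di _] : (i.+1 <= dyck_at n d i.+1 <= n)%N by apply: hi; rewrite i_n.
exact: leq_trans di dj.
Qed.

Lemma dyck_lt_mono (i i' j j' : 'I_n) :
  (i' <= i)%N -> dyck_lt d i j -> (j <= j')%N -> dyck_lt d i' j'.
Proof.
move=> ii; rewrite !dyck_ltE => /andP[i_n dj] jj.
rewrite (leq_ltn_trans _ i_n) //=; apply: leq_trans (dyck_mono ii i_n) _.
exact: leq_trans dj jj.
Qed.

Lemma dyck_height (m0 m1 : nat) C :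
  nth n d 0%N = m0 -> nth n d m0 = m1 -> nth n d m1 = n ->
  chain (@dyck_lt n d) C -> (#|C| <= 3)%N.
Proof.
move=> e0 e1 e2 /chainP chC.
pose lev (v : 'I_n) : 'I_3 := inord ((m0 <= v) + (m1 <= v))%N.
suff inj : {in C &, injective lev}.
  by rewrite -(card_in_imset inj) -[X in (_ <= X)%N]card_ord max_card.
have key (u v : 'I_n) : u \in C -> v \in C -> (u < v)%N -> lev u <> lev v.
  move=> uC vC uv; have := chC u v uC vC uv; rewrite dyck_ltE => /andP[un duv].
  have h0 := dyck_mono (leq0n u) un.
  have h1 : (m0 <= u)%N -> (m1 <= v)%N.
    by move=> mu; rewrite -e1; apply: leq_trans (dyck_mono mu un) duv.
  have h2 : (m1 <= u)%N -> False.
    move=> mu; have := leq_trans (dyck_mono mu un) duv; rewrite e2 leqNgt.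
    by rewrite ltn_ord.
  have lev3 (z : 'I_n) : ((m0 <= z) + (m1 <= z) < 3)%N by case: (m0 <= z)%N; case: (m1 <= z)%N.
  move=> /(congr1 val); rewrite /lev /= !inordK //.
  have m0v : (m0 <= v)%N by apply: leq_trans duv; rewrite -e0.
  have m1u : (m1 <= u)%N = false by apply/negbTE/negP.
  rewrite m0v m1u; have [mu|] := leqP m0 u; first by rewrite h1.
  by case: (m1 <= v)%N.
move=> u v uC vC e; case: (ltngtP u v) => [uv|vu|/val_inj//].
  by case: (key u v).
by case: (key v u).
Qed.

End Dyck.

Lemma card_blocks (n m0 m1 m2 : nat) : (m0 <= m1)%N ->
  (#|bounce_block n [:: m0; m1; m2] 0| + #|bounce_block n [:: m0; m1; m2] 1| +
   #|bounce_block n [:: m0; m1; m2] 2| <= n)%N.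
Proof.
move=> m01; rewrite -[n in (_ <= n)%N]card_ord.
set A := bounce_block _ _ 0; set B := bounce_block _ _ 1; set C := bounce_block _ _ 2.
have dAB : A :&: B = set0.
  by apply/setP => v; rewrite !inE /=; lia.
have dABC : (A :|: B) :&: C = set0.
  by apply/setP => v; rewrite !inE /=; lia.
have := cardsUI A B; rewrite dAB cards0 addn0 => <-.
have := cardsUI (A :|: B) C; rewrite dABC cards0 addn0 => <-.
exact: max_card.
Qed.

Close Scope ring_scope.

Theorem theorem3p5 (n : nat) (d m : seq nat) (hd : dyck_path n d)
    (hm : bounce_seq n d m) (hm3 : size m = 3) :
  let G : rel 'I_n := inc_graph (dyck_lt d) in
  let c := #|bounce_block n m 0| in
  let b := #|bounce_block n m 1| in
  let a := #|bounce_block n m 2| in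
  (exists f : {fsfun intpart -> {poly int} with 0%R}, e_expansion G f) /\
  (forall f : {fsfun intpart -> {poly int} with 0%R}, e_expansion G f ->
   forall l : nat, l <= minn a (minn b c) ->
     f (mkpart [:: n - 2 * l; l; l]) \is a polyOver (Num.nat : {pred int})).
Proof.
move=> G c b a.
have prec_lt := dyck_lt_lt hd; have prec_mono := dyck_lt_mono hd.
split=> [|f fE l]; first exact: e_expansion_exists.
rewrite !leq_min => /and3P[la lb lc].
case: m hm hm3 @c @b @a la lb lc => [|m0 [|m1 [|m2 []]]] //= /and3P[/eqP e0].
rewrite andbT => /andP[/andP[m0n /eqP e1] /andP[m1n /eqP e2]] /eqP m2n _ la lb lc.
have n0 : 0 < n.
  rewrite lt0n; apply: contraNneq m0n => n0; rewrite e0 /dyck_at nth_default //.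
  by case: hd => ->; rewrite n0.
have e0' : nth n d 0 = m0 by rewrite e0.
have e1' : nth n d m0 = m1 by rewrite e1.
have e2' : nth n d m1 = n by rewrite -[RHS]m2n e2.
have m0lt : m0 < n by rewrite ltn_neqAle m0n -e0'; case/andP: (dyck_bound hd n0).
have m01 : m0 <= m1 by rewrite -e1' ltnW //; case/andP: (dyck_bound hd m0lt).
have l3n : 3 * l <= n.
  rewrite !mulSn mul0n addn0 addnA.
  by apply: leq_trans (card_blocks n m2 m01); rewrite !leq_add.
apply/polyOverP => i; rewrite Znat_def.
by apply: (npoly_e_coef prec_lt prec_mono (fun C => dyck_height hd e0' e1' e2')).
Qed.
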